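(* Let $\mathfrak S$ be an operator semiperfect $*$-semigroup, let $T$ be a symmetric subset of $\mathfrak S$ (i.e. $T=T^*:=\{s^*\colon s\in T\}$) containing the set $\mathfrak S_{\mathfrak h}=\{s\in\mathfrak S\colon s=s^*\}$ of all Hermitian elements, and let $Y$ be a determining subset of $\mathfrak X_{\mathfrak S}$. If $\mathcal D$ is a complex linear space, then for every mapping $\Phi\colon T\to\mathcal S(\mathcal D)$ the following four conditions are equivalent: (i) $\Phi$ extends to a positive definite mapping $\Psi\colon\mathfrak S\to\mathcal S(\mathcal D)$; (ii) there is a semispectral measure $\mu\colon\mathsf M_{\mathfrak S}\to\mathcal S(\mathcal D)$ such that $\Phi(s)=\int_{\mathfrak X_{\mathfrak S}}\hat s\,d\mu$ for all $s\in T$; (iii) $\Lambda_{\Phi}:=\Lambda_{\Phi,\mathfrak X_{\mathfrak S}}$ is completely positive; (iv) $\Lambda_{\Phi,Y}$ is completely f-positive.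
   Context: A $*$-semigroup is a semigroup $\mathfrak S$ (written multiplicatively) with an involution $s\mapsto s^*$ satisfying $(st)^*=t^*s^*$ and $(s^* )^*=s$. Let $\mathfrak S$ be a commutative $*$-semigroup with unit $\varepsilon$. A character of $\mathfrak S$ is a function $\chi\colon\mathfrak S\to\mathbb C$ with $\chi(st)=\chi(s)\chi(t)$, $\chi(s^* )=\overline{\chi(s)}$, $\chi(\varepsilon)=1$; $\mathfrak X_{\mathfrak S}$ is the set of all characters, and for $s\in\mathfrak S$, $\hat s\colon\mathfrak X_{\mathfrak S}\to\mathbb C$ is $\hat s(\chi)=\chi(s)$. A nonempty $Y\subset\mathfrak X_{\mathfrak S}$ is determining if the system $\{\hat s|_Y\}_{s\in\mathfrak S}$ is linearly independent in $\mathbb C^Y$ (if some determining $Y$ exists, then $\mathfrak X_{\mathfrak S}$ is itself determining). For nonempty $T\subset\mathfrak S$ and nonempty $Y\subset\mathfrak X_{\mathfrak S}$: $\mathcal P_T(Y)$ is the linear span of $\{\hat s|_Y\colon s\in T\}$ in $\mathbb C^Y$; $\mathcal P(Y,\ell^2)$ is the set of all functions $Y\to\ell^2$ of the form $\chi\mapsto\sum_{s\in\mathfrak S}\chi(s)x_s$ with $x_s\in\ell^2$, $x_s=0$ for all but finitely many $s$; for $p,q\in\mathcal P(Y,\ell^2)$, $\langle\!\langle p,q\rangle\!\rangle$ is the function $\chi\mapsto\langle p(\chi),q(\chi)\rangle_{\ell^2}$ on $Y$. For $m\ge1$, $\mathrm M^m(\mathcal P_T(Y))$ is the set of $m\times m$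 matrices with entries in $\mathcal P_T(Y)$; $\mathrm M^m_{+}(\mathcal P_T(Y))$ is the set of those $[w_{k,l}]$ in it for which the scalar matrix $[w_{k,l}(\chi)]_{k,l=1}^m$ is nonnegative (positive semidefinite) for every $\chi\in Y$; $\mathrm M^m_{\mathrm f}(\mathcal P_T(Y))$ is the set of those matrices in $\mathrm M^m(\mathcal P_T(Y))$ of the form $[\langle\!\langle p_k,p_l\rangle\!\rangle]_{k,l=1}^m$ with $p_1,\dots,p_m\in\mathcal P(Y,\ell^2)$. $\mathcal S(\mathcal D)$ is the set of all sesquilinear forms on $\mathcal D$, and $\mathrm M^m_+(\mathcal S(\mathcal D))$ is the set of $m\times m$ matrices $[\phi_{k,l}]$ with entries in $\mathcal S(\mathcal D)$ such that $\sum_{k,l=1}^m\phi_{k,l}(h_k,h_l)\ge0$ for all $h_1,\dots,h_m\in\mathcal D$. A mapping $\Psi\colon\mathfrak S\to\mathcal S(\mathcal D)$ is positive definite if $\sum_{k,l=1}^m\Psi(s_l^*s_k)(h_k,h_l)\ge0$ for all $m\ge1$, $s_1,\dots,s_m\in\mathfrak S$, $h_1,\dots,h_m\in\mathcal D$. If $Y$ is determining and $\Phi\colon T\to\mathcal S(\mathcal D)$, then $\Lambda_{\Phi,Y}\colon\mathcal P_T(Y)\to\mathcal S(\mathcal D)$ is the unique linear mapping with $\Lambda_{\Phi,Y}(\hat s|_Y)=\Phi(s)$ for $s\in T$. It is completely positive (respectively completely f-positive) if for every $m\ge1$ and every $[w_{k,l}]\in\mathrm M^m_+(\mathcal P_T(Y))$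 (respectively $[w_{k,l}]\in\mathrm M^m_{\mathrm f}(\mathcal P_T(Y))$) one has $[\Lambda_{\Phi,Y}(w_{k,l})]_{k,l=1}^m\in\mathrm M^m_+(\mathcal S(\mathcal D))$. A semispectral measure on a $\sigma$-algebra $\mathsf M$ is a mapping $\mu\colon\mathsf M\to\mathcal S(\mathcal D)$ such that $\mu(\cdot)(f,f)$ is a finite positive measure for every $f\in\mathcal D$. $\mathsf M_{\mathfrak S}$ is the smallest $\sigma$-algebra of subsets of $\mathfrak X_{\mathfrak S}$ making all $\hat s$, $s\in\mathfrak S$, measurable. An equality $\Psi(s)=\int_{\mathfrak X_{\mathfrak S}}\hat s\,d\mu$ means $\Psi(s)(f,g)=\int_{\mathfrak X_{\mathfrak S}}\hat s(\chi)\,\mu(d\chi)(f,g)$ for all $f,g\in\mathcal D$, all integrands being tacitly assumed summable. A unital commutative $*$-semigroup $\mathfrak S$ is operator semiperfect if for every complex linear space $\mathcal D$ and every positive definite $\Psi\colon\mathfrak S\to\mathcal S(\mathcal D)$ there is a semispectral measure $\mu\colon\mathsf M_{\mathfrak S}\to\mathcal S(\mathcal D)$ with $\Psi(s)=\int_{\mathfrak X_{\mathfrak S}}\hat s\,d\mu$ for all $s\in\mathfrak S$. *)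

(* Defs.v *)
From HB Require Import structures.
From mathcomp Require Import all_boot all_order all_algebra.
From mathcomp Require Import all_classical all_reals all_analysis.
From mathcomp Require Import complex.

(* The complex field is R[i] over R : realType; as
   a topological space and as a module over itself it is written R[i]^o.
   A unital *-semigroup is a starMonoidType: its multiplication, unit and
   involution are written s * t, 1 and s^-1 in group_scope (s^-1 is the adjoint
   of s, not an inverse).  On R[i], 0 <= z means that z is real and >= 0. *)

Set Implicit Arguments.
Unset Strict Implicit.
Unset Printing Implicit Defensive.

Import Order.TTheory GRing.Theory Num.Theory numFieldNormedType.Exports.

Local Open Scope classical_set_scope.
Local Open Scope complex_scope.
Local Open Scope ring_scope.

Section SesquilinearForms.
Variables (R : realType) (D : lmodType R[i]).

(* linear in the first argument, conjugate-linear in the second *)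
Definition sform := {bilinear D -> D -> R[i] | *%R & Num.conj \; *%R}.

Lemma sformP (phi psi : sform) : (forall f g, phi f g = psi f g) -> phi = psi.
Proof.
case: phi psi => [u [[u1 u2 u3 u4]]] [v [[v1 v2 v3 v4]]] /= uv.
have {}uv : u = v by apply/funext => f; apply/funext => g; exact: uv.
case: v / uv v1 v2 v3 v4 => v1 v2 v3 v4.
by congr Bilinear.Pack; congr Bilinear.Class; congr isBilinear.Axioms_;
  apply: Prop_irrelevance.
Qed.

Lemma sformPl (phi : sform) c f f' g :
  phi (c *: f + f') g = c * phi f g + phi f' g.
Proof. exact: (linearPl phi g c). Qed.

Lemma sformPr (phi : sform) c f g g' :
  phi f (c *: g + g') = Num.conj c * phi f g + phi f g'.
Proof. exact: (linearPr phi f c). Qed.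

Lemma sform_comb_bilinear (a : R[i]) (phi psi : sform) :
  bilinear_for ( *%R : GRing.Scale.law _ _)
    (Num.conj \; *%R : GRing.Scale.law _ _)
    (fun f g => a * phi f g + psi f g).
Proof.
split=> [g c f f'|f c g g'] /=.
  by rewrite !sformPl /= !mulrDr !mulrA (mulrC a) addrACA.
by rewrite !sformPr /= !mulrDr !mulrA (mulrC a) addrACA.
Qed.

Definition sform_comb (a : R[i]) (phi psi : sform) : sform :=
  HB.pack_for sform (fun f g => a * phi f g + psi f g)
    (bilinear_isBilinear.Build _ _ _ _ _ _ _ (sform_comb_bilinear a phi psi)).

Lemma sform_zero_bilinear :
  bilinear_for ( *%R : GRing.Scale.law _ _)
    (Num.conj \; *%R : GRing.Scale.law _ _) (fun _ _ : D => 0 : R[i]).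
Proof. by split=> [g c f f'|f c g g'] /=; rewrite mulr0 addr0. Qed.

Definition sform_zero : sform :=
  HB.pack_for sform (fun _ _ : D => 0 : R[i])
    (bilinear_isBilinear.Build _ _ _ _ _ _ _ sform_zero_bilinear).

HB.instance Definition _ := gen_eqMixin sform.
HB.instance Definition _ := gen_choiceMixin sform.

Definition sform_add := sform_comb 1.
Definition sform_opp phi := sform_comb (-1) phi sform_zero.
Definition sform_scale a phi := sform_comb a phi sform_zero.

Lemma sform_addA : associative sform_add.
Proof. by move=> p q r; apply: sformP => f g; rewrite /= !mul1r addrA. Qed.
Lemma sform_addC : commutative sform_add.
Proof. by move=> p q; apply: sformP => f g; rewrite /= !mul1r addrC. Qed.
Lemma sform_add0 : left_id sform_zero sform_add.
Proof. by move=> p; apply: sformP => f g; rewrite /= mul1r add0r. Qed.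
Lemma sform_addN : left_inverse sform_zero sform_opp sform_add.
Proof.
by move=> p; apply: sformP => f g; rewrite /= mul1r mulN1r addr0 addNr.
Qed.

HB.instance Definition _ :=
  GRing.isZmodule.Build sform sform_addA sform_addC sform_add0 sform_addN.

Lemma sform_scaleA a b phi :
  sform_scale a (sform_scale b phi) = sform_scale (a * b) phi.
Proof. by apply: sformP => f g; rewrite /= !addr0 mulrA. Qed.
Lemma sform_scale1 : left_id 1 sform_scale.
Proof. by move=> p; apply: sformP => f g; rewrite /= mul1r addr0. Qed.
Lemma sform_scaleDr : right_distributive sform_scale +%R.
Proof.
by move=> a p q; apply: sformP => f g; rewrite /= !mul1r !addr0 mulrDr.
Qed.
Lemma sform_scaleDl phi : {morph sform_scale^~ phi : a b / a + b}.
Proof. by move=> a b; apply: sformP => f g; rewrite /= !addr0 mul1r mulrDl. Qed.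

HB.instance Definition _ := GRing.Zmodule_isLmodule.Build R[i] sform
  sform_scaleA sform_scale1 sform_scaleDr sform_scaleDl.

Lemma sformZE a (phi : sform) f g : (a *: phi) f g = a * phi f g.
Proof. by rewrite /= addr0. Qed.

Lemma sformDE (phi psi : sform) f g : (phi + psi) f g = phi f g + psi f g.
Proof. by rewrite /= mul1r. Qed.

Lemma sform_sumE n (F : 'I_n -> sform) f g :
  (\sum_i F i) f g = \sum_i F i f g.
Proof.
elim: n F => [|n IH] F; first by rewrite !big_ord0.
by rewrite !big_ord_recl sformDE IH.
Qed.

End SesquilinearForms.

Section Characters.
Variables (R : realType) (S : starMonoidType).

Record character := Character {
  char_fun :> S -> R[i];
  charM : forall s t, char_fun (s * t)%g = char_fun s * char_fun t;
  charV : forall s, char_fun (s^-1)%g = Num.conj (char_fun s);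
  char1 : char_fun 1%g = 1 }.

HB.instance Definition _ := gen_eqMixin character.
HB.instance Definition _ := gen_choiceMixin character.

Definition trivial_character : character.
Proof.
by exists (fun=> 1) => // [s t|s]; rewrite ?mulr1 ?rmorph1.
Defined.

HB.instance Definition _ := isPointed.Build character trivial_character.

(* the sets [hat s]^-1(U), with U open in the complex plane: they generate the
   smallest sigma-algebra making every [hat s] Borel measurable *)
Definition hat_preimages : set (set character) :=
  [set A | exists s (U : set R[i]^o),
     open U /\ A = (fun chi : character => chi s) @^-1` U].

HB.instance Definition _ :=
  Measurable.copy character (g_sigma_algebraType hat_preimages).

Lemma character_measurableE :
  (measurable : set (set character)) = <<s hat_preimages >>.
Proof. by []. Qed.

Definition hat (Y : set character) (s : S) : Y -> R[i]^o :=
  fun chi => set_val chi s.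
Arguments hat Y s _ : clear implicits.

Definition determining (Y : set character) :=
  Y !=set0 /\
  forall n (s : 'I_n -> S) (c : 'I_n -> R[i]), injective s ->
    \sum_i c i *: hat Y (s i) = 0 -> forall i, c i = 0.

End Characters.

Arguments hat {R S} Y s _.

Lemma lin_comb_cat (K : nzRingType) (I : Type) (a : K) n (c : 'I_n -> K)
    (s : 'I_n -> I) m (d : 'I_m -> K) (t : 'I_m -> I) :
  exists k (e : 'I_k -> K) (r : 'I_k -> I),
    forall (V : lmodType K) (F : I -> V), \sum_i e i *: F (r i) =
      a *: (\sum_i c i *: F (s i)) + \sum_i d i *: F (t i).
Proof.
pose pick (A : Type) (f : 'I_n -> A) (g : 'I_m -> A) (i : 'I_(n + m)) :=
  match fintype.split i with inl j => f j | inr j => g j end.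
have pickl A f g i : pick A f g (lshift m i) = f i.
  by rewrite /pick (unsplitK (inl i)).
have pickr A f g i : pick A f g (rshift n i) = g i.
  by rewrite /pick (unsplitK (inr i)).
exists (n + m), (pick _ (fun i => a * c i) d), (pick _ s t) => V F.
rewrite big_split_ord /= scaler_sumr.
by congr (_ + _); apply: eq_bigr => i _; rewrite ?pickl ?pickr// scalerA.
Qed.

Section PolynomialSpace.
Variables (R : realType) (S : starMonoidType).
Variables (T : set S) (Y : set (character R S)).

Definition hat_span : set (Y -> R[i]^o) :=
  [set w | exists n (c : 'I_n -> R[i]) (s : 'I_n -> T),
             w = \sum_i c i *: hat Y (set_val (s i))].

Definition in_hat_span : {pred Y -> R[i]^o} := mem hat_span.

Lemma hat_span_submod : submod_closed in_hat_span.
Proof.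
split=> [|a u v].
  rewrite /in_hat_span inE; exists 0, (fun=> 0).
  by exists (fun i : 'I_0 => False_rect _ (notF (ltn_ord i))); rewrite big_ord0.
rewrite /in_hat_span !inE => -[n [c [s ->]]] [m [d [t ->]]].
have [k [e [r er]]] := lin_comb_cat a c s d t; exists k, e, r.
by rewrite (er _ (fun s => hat Y (set_val s))).
Qed.

HB.instance Definition _ :=
  GRing.isSubmodClosed.Build R[i] (Y -> R[i]^o) in_hat_span hat_span_submod.

Record polyT := PolyT {
  polyT_fun :> Y -> R[i]^o;
  polyT_subproof : polyT_fun \in in_hat_span }.

HB.instance Definition _ := [isSub for polyT_fun].
HB.instance Definition _ := [Choice of polyT by <:].
HB.instance Definition _ := [SubChoice_isSubLmodule of polyT by <:].

Lemma hat_in_span (s : T) : hat Y (set_val s) \in in_hat_span.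
Proof.
rewrite /in_hat_span inE; exists 1, (fun=> 1), (fun=> s).
by rewrite big_ord1 scale1r.
Qed.

Definition hatT (s : T) : polyT := PolyT (hat_in_span s).

Lemma polyT_rep (w : polyT) : exists n (c : 'I_n -> R[i]) (s : 'I_n -> T),
  w = \sum_i c i *: hatT (s i).
Proof.
case: w => w /[dup] /set_mem [n [c [s e]]] ws; exists n, c, s.
apply: val_inj; rewrite raddf_sum [LHS]e.
by apply: eq_bigr.
Qed.

End PolynomialSpace.

Arguments hatT {R S T} Y s.

Section Lambda.
Variables (R : realType) (S : starMonoidType) (D : lmodType R[i]).
Variables (T : set S) (Y : set (character R S)) (Phi : T -> sform D).

Definition Lambda_spec (L : polyT T Y -> sform D) :=
  linear L /\ forall s : T, L (hatT Y s) = Phi s.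

(* the linear map sending the restriction of [hat s] to Phi s, for s in T; when
   Y is determining it exists and is unique (LambdaP, Lambda_unique) *)
Definition Lambda : polyT T Y -> sform D := xget (fun=> 0) Lambda_spec.

Lemma Lambda_spec_sum L n (c : 'I_n -> R[i]) (s : 'I_n -> T) :
  Lambda_spec L -> L (\sum_i c i *: hatT Y (s i)) = \sum_i c i *: Phi (s i).
Proof.
move=> [Llin Lhat].
have L0 : L 0 = 0 by have := Llin (-1) 0 0; rewrite scaler0 addr0 scaleN1r addNr.
elim: n c s => [|n IH] c s; first by rewrite !big_ord0.
by rewrite !big_ord_recl Llin IH Lhat.
Qed.

Lemma Lambda_unique L L' : Lambda_spec L -> Lambda_spec L' -> L = L'.
Proof.
move=> HL HL'; apply/funext => w; have [n [c [s ->]]] := polyT_rep w.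
by rewrite !Lambda_spec_sum.
Qed.

Lemma determining_comb0 n (c : 'I_n -> R[i]) (s : 'I_n -> T) :
  determining Y -> \sum_i c i *: hatT Y (s i) = 0 ->
  \sum_i c i *: Phi (s i) = 0.
Proof.
move=> [_ dY] c0.
pose u := undup (codom s); pose v (k : 'I_(size u)) := tnth (in_tuple u) k.
pose d k := \sum_(i | s i == v k) c i.
have collect (V : lmodType R[i]) (F : T -> V) :
    \sum_i c i *: F (s i) = \sum_k d k *: F (v k).
  have su i : (index (s i) u < size u)%N.
    by rewrite index_mem mem_undup codom_f.
  have uu : uniq u := undup_uniq _.
  have vE i k : (Ordinal (su i) == k) = (s i == v k).
    apply/eqP/eqP => [<-|e].
      by rewrite /v (tnth_nth (s i)) /= nth_index// mem_undup codom_f.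
    apply: val_inj => /=; rewrite e /v (tnth_nth (s i)) /=.
    by rewrite index_uniq.
  rewrite (partition_big (fun i => Ordinal (su i)) xpredT)//=.
  apply: eq_bigr => k _; rewrite scaler_suml.
  under eq_bigl do rewrite vE.
  by apply: eq_bigr => i /eqP ->.
rewrite collect big1// => k _; rewrite (dY _ (set_val \o v) d) ?scale0r//.
  move=> i j /= /val_inj; rewrite /v !(tnth_nth (v i)) /= => /eqP.
  by rewrite nth_uniq ?undup_uniq// => /eqP /val_inj.
move: c0; rewrite collect => /(congr1 val); rewrite raddf_sum /= => c0.
by rewrite -[RHS]c0; apply: eq_bigr.
Qed.

Lemma LambdaP : determining Y -> Lambda_spec Lambda.
Proof.
move=> dY; suff [L HL] : exists L, Lambda_spec L by exact: (xgetI _ HL).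
pose G (w : polyT T Y) (phi : sform D) := exists n (c : 'I_n -> R[i]) s,
  w = \sum_i c i *: hatT Y (s i) /\ phi = \sum_i c i *: Phi (s i).
have Gcomb a w phi w' psi : G w phi -> G w' psi -> G (a *: w + w') (a *: phi + psi).
  move=> [n [c [s [-> ->]]]] [m [d [t [-> ->]]]].
  by have [k [e [r er]]] := lin_comb_cat a c s d t; exists k, e, r; rewrite !er.
have G0 phi : G 0 phi -> phi = 0.
  by move=> [n [c [s [/esym c0 ->]]]]; exact: determining_comb0.
have Guniq w phi psi : G w phi -> G w psi -> phi = psi.
  move=> Gp Gq; have := Gcomb (-1) _ _ _ _ Gp Gq.
  by rewrite !scaleN1r addNr => /G0 /eqP; rewrite addrC subr_eq0 => /eqP.
have /choice [L HL] : forall w, exists phi, G w phi.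
  move=> w; have [n [c [s e]]] := polyT_rep w.
  by exists (\sum_i c i *: Phi (s i)), n, c, s.
exists L; split=> [a u v|s].
  exact: (Guniq _ _ _ (HL _) (Gcomb _ _ _ _ _ (HL u) (HL v))).
apply: (Guniq _ _ _ (HL _)); exists 1, (fun=> 1), (fun=> s).
by rewrite !big_ord1 !scale1r.
Qed.

End Lambda.

Arguments Lambda {R S D T} Y Phi _.

Section CompletePositivity.
Variables (R : realType) (S : starMonoidType).

Definition mx_nonneg m (A : 'M[R[i]]_m) :=
  forall z : 'cV[R[i]]_m, 0 <= (map_mx Num.conj z^T *m A *m z) 0 0.

Definition sform_mx_nonneg (D : lmodType R[i]) m (A : 'M[sform D]_m) :=
  forall h : 'I_m -> D, 0 <= \sum_k \sum_l A k l (h k) (h l).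

Definition ell2 (x : nat -> R[i]) :=
  cvgn (series ((fun n => `|x n| ^+ 2) : nat -> R[i]^o)).

Definition ell2_dot (x y : nat -> R[i]) : R[i] :=
  limn (series ((fun n => x n * Num.conj (y n)) : nat -> R[i]^o)).

(* an element of l^2 is a sequence satisfying ell2, with pointwise operations *)
Definition ell2_poly (Y : set (character R S)) (p : Y -> nat -> R[i]) :=
  exists (r : seq S) (x : S -> nat -> R[i]),
    [/\ uniq r, forall s, ell2 (x s), forall s, s \notin r -> x s = fun=> 0 &
        p = fun chi n => \sum_(s <- r) set_val chi s * x s n].

Section Matrices.
Variables (T : set S) (Y : set (character R S)) (m : nat).

Definition pos_polymx (W : 'M[polyT T Y]_m) :=
  forall chi : Y, mx_nonneg (\matrix_(k, l) W k l chi).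

Definition f_polymx (W : 'M[polyT T Y]_m) :=
  exists p : 'I_m -> Y -> nat -> R[i], (forall k, ell2_poly (p k)) /\
    forall k l (chi : Y), W k l chi = ell2_dot (p k chi) (p l chi).

End Matrices.

Section Maps.
Variables (D : lmodType R[i]) (T : set S) (Y : set (character R S)).

Definition completely_positive (L : polyT T Y -> sform D) :=
  forall m (W : 'M[polyT T Y]_m), (0 < m)%N -> pos_polymx W ->
    sform_mx_nonneg (map_mx L W).

Definition completely_f_positive (L : polyT T Y -> sform D) :=
  forall m (W : 'M[polyT T Y]_m), (0 < m)%N -> f_polymx W ->
    sform_mx_nonneg (map_mx L W).

End Maps.

Definition positive_definite (D : lmodType R[i]) (Psi : S -> sform D) :=
  forall m (s : 'I_m -> S) (h : 'I_m -> D), (0 < m)%N ->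
    0 <= \sum_k \sum_l Psi ((s l)^-1 * s k)%g (h k) (h l).

End CompletePositivity.

Section ComplexMeasures.
Context d (X : measurableType d) (R : realType).

Local Notation Rpart := (@complex.Re R).
Local Notation Ipart := (@complex.Im R).

Definition charge_pos (nu : {charge set X -> \bar R}) :=
  jordan_pos (projT2 (cid (projT2 (cid (Hahn_decomposition nu))))).

Definition charge_neg (nu : {charge set X -> \bar R}) :=
  jordan_neg (projT2 (cid (projT2 (cid (Hahn_decomposition nu))))).

Definition charge_integrable (nu : {charge set X -> \bar R}) (f : X -> R) :=
  (charge_pos nu).-integrable setT (EFin \o f) /\
  (charge_neg nu).-integrable setT (EFin \o f).

Definition charge_integral (nu : {charge set X -> \bar R}) (f : X -> R) : R :=
  Rintegral (charge_pos nu) setT f - Rintegral (charge_neg nu) setT f.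

(* the set function nu is a complex measure, with real and imaginary parts nu1
   and nu2, the function h is summable for (the total variation of) nu, and
   z is the integral of h with respect to nu *)
Definition is_complex_integral (nu : set X -> R[i]) (h : X -> R[i]) (z : R[i]) :=
  exists nu1 nu2 : {charge set X -> \bar R},
  [/\ forall A, measurable A -> nu A = fine (nu1 A) +i* fine (nu2 A),
      charge_integrable nu1 (Rpart \o h)
        /\ charge_integrable nu1 (Ipart \o h),
      charge_integrable nu2 (Rpart \o h)
        /\ charge_integrable nu2 (Ipart \o h) &
      z = (charge_integral nu1 (Rpart \o h)
             - charge_integral nu2 (Ipart \o h))
       +i* (charge_integral nu1 (Ipart \o h)
             + charge_integral nu2 (Rpart \o h))].

End ComplexMeasures.

Section Semispectral.
Variables (R : realType) (S : starMonoidType) (D : lmodType R[i]).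

(* only the values of mu on measurable sets matter *)
Definition semispectral (mu : set (character R S) -> sform D) :=
  forall f : D, exists m : {finite_measure set (character R S) -> \bar R},
    forall A, measurable A -> mu A f f = (fine (m A))%:C.

Definition is_moment (mu : set (character R S) -> sform D) (s : S)
    (phi : sform D) :=
  forall f g : D, is_complex_integral (fun A => mu A f g)
    (fun chi : character R S => chi s) (phi f g).

End Semispectral.

Definition operator_semiperfect (R : realType) (S : starMonoidType) :=
  (forall s t : S, (s * t)%g = (t * s)%g) /\
  forall (D : lmodType R[i]) (Psi : S -> sform D), positive_definite Psi ->
    exists mu : set (character R S) -> sform D,
      semispectral mu /\ forall s, is_moment mu s (Psi s).

(* Main.v *)
(* (ii) => (iii): by polarization only the finite measures mu(.)(f, f) matter,
   and on a cell of a countable measurable partition where the polynomials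
   w_(k,l) are nearly constant the required positivity is that of the Hadamard
   product of two nonnegative matrices.
   (iii) => (iv): since Y is determining, an identity w_(k,l) = <<p_k, p_l>> on Y
   is one of formal combinations of elements of S, hence holds for all
   characters.
   (iv) => (i): M. Riesz extension.  Positive definite maps are the functionals
   nonnegative on the cone of sums of squares in (the self-adjoint part of)
   C[S] (x) D (x) conj D; (iv) says that Phi is nonnegative on the part of the
   cone supported by T.  As T contains every s^* s, a square is dominated by
   an element supported by T, namely by a sum of squares of single terms. *)

From HB Require Import structures.
Require Import Defs.
From mathcomp Require Import all_boot all_order all_algebra.
From mathcomp Require Import all_classical all_reals all_analysis.
From mathcomp Require Import complex measurable_realfun.
From mathcomp Require Import ring lra.

Set Implicit Arguments.
Unset Strict Implicit.
Unset Printing Implicit Defensive.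

Import Order.TTheory GRing.Theory Num.Theory numFieldNormedType.Exports.

Local Open Scope classical_set_scope.
Local Open Scope ring_scope.

(** * M. Riesz extension *)

(** Two obstacles shape (iv) => (i). No tensor product is built and no basis of D is chosen: a
    formal term carrying s, h, k is the real function [ev s h k] on the set of Hermitian maps. That
    a sum of squares is supported by T is then an equality of functions, whereas f-positivity asks
    for polynomials <<p_k, p_l>> lying in P_T(Y). The passage between the two evaluates the equality
    at the maps s |-> chi(s) B, with B a Hermitian form made of two coordinate functionals; one
    equality involves finitely many vectors, so a finite biorthogonal family supplies the
    coordinates. The second obstacle is that the Riesz argument is real. The functional to extend is
    evaluation at [Phi] prolonged by zero, which makes sense only once this map is known to be
    Hermitian; that comes from the squares of the two-term elements with points s and 1. The complex
    form is recovered at the end through Im z = Re(-i z). In (ii) => (iii) no density is used: the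
    discretisation error is e times a total mass, and adding absolute values to the integrands
    reduces the countable sums to nonnegative terms. *)

Section RieszExtension.
Variables (R : realType) (V : lmodType R) (M C : set V) (f0 : V -> R^o).
Hypotheses (f0_lin : linear f0) (M0 : M 0)
  (M_lin : forall a x y, M x -> M y -> M (a *: x + y)).
Hypotheses (C0 : C 0) (C_add : forall x y, C x -> C y -> C (x + y))
  (C_scale : forall a x, 0 <= a -> C x -> C (a *: x)).
Hypothesis C_dom : forall x, C x -> exists2 y, M y & C (y - x).
Hypothesis f0_pos : forall x, M x -> C x -> 0 <= f0 x.

(* A partial functional is encoded by its graph G; positivity alone forces
   G to be single-valued, since 0 belongs to C. *)
Let partial_ext (G : set (V * R^o)) :=
  [/\ forall a u v, G u -> G v -> G (a *: u + v),
      forall u, G u -> C u.1 -> 0 <= u.2 &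
      forall u y, G u -> M y -> G (u + (y, f0 y))].

Let partial_ext_max : exists G, [/\ partial_ext G, forall y, M y -> G (y, f0 y) &
  forall G', partial_ext G' -> G `<=` G' -> G' `<=` G].
Proof.
have f00 : f0 0 = 0.
  by have := f0_lin (-1) 0 0; rewrite scaler0 addr0 scaleN1r addNr.
have [F FP tF|G [PG Gmax]] := @Zorn_bigcup _ partial_ext.
  split=> [a u v [X FX Xu] [Y FY Yv]|u [X FX Xu]|u y [X FX Xu] My].
  - have [XY|YX] := tF _ _ FX FY.
      by exists Y => //; have [+ _ _] := FP _ FY; apply=> //; exact: XY.
    by exists X => //; have [+ _ _] := FP _ FX; apply=> //; exact: YX.
  - by have [_ + _] := FP _ FX; apply.
  - by exists X => //; have [_ _] := FP _ FX; apply.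
exists G.
have maxG G' : partial_ext G' -> G `<=` G' -> G' `<=` G.
  move=> PG' GG'; apply: contrapT => nG'; exact: (Gmax G').
split=> // y My; have [lG _ eG] := PG.
(* The last clause of [partial_ext] asks for stability under the graph of [f0], not for containing
   it, so that the union of an empty chain qualifies. Hence the maximal graph could a priori be
   empty; the graph of [f0] over [M] rules this out. *)
suff [u Gu] : G !=set0.
  have /= := eG _ _ (lG (-1) _ _ Gu Gu) My.
  by rewrite scaleN1r addNr add0r.
apply: contrapT => /set0P/negP/negPn/eqP G0.
pose G' := [set u : V * R^o | M u.1 /\ u.2 = f0 u.1].
have PG' : partial_ext G'.
  split=> [a [x b] [z c] [/= Mx bE] [/= Mz cE]|[x b] [/= Mx bE] Cx|
    [x b] z [/= Mx bE] Mz].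
  - by split=> /=; [exact: M_lin|rewrite bE cE f0_lin].
  - by rewrite bE; exact: f0_pos.
  - split=> /=; first by rewrite -(scale1r x); exact: M_lin.
    by rewrite bE -{2}(scale1r x) f0_lin scale1r.
have : G' `<=` G by apply: maxG => //; rewrite G0.
by move/(_ (0, 0)); rewrite G0; apply; split.
Qed.

(** A value at a new point [x] must lie between those at its minorants and majorants in the domain.
    Domination is assumed for elements of [C] only: it makes minorants exist as soon as majorants
    do, and conversely, but both may be absent, and then any value is admissible. *)
Theorem riesz_extension : exists f : V -> R^o,
  [/\ linear f, forall y, M y -> f y = f0 y & forall x, C x -> 0 <= f x].
Proof.
have [G [[lG pG eG] MG maxG]] := partial_ext_max.
have f00 : f0 0 = 0.
  by have := f0_lin (-1) 0 0; rewrite scaler0 addr0 scaleN1r addNr.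
have G0 : G (0, 0) by rewrite -f00; exact: MG.
have Gs a x b : G (x, b) -> G (a *: x, a * b).
  by move=> /(lG a _ _)/(_ G0); rewrite addr0.
have GD x b y c : G (x, b) -> G (y, c) -> G (x + y, b + c).
  by move=> /(lG 1 _ _) H /H; rewrite scale1r.
have GB x b y c : G (x, b) -> G (y, c) -> G (x - y, b - c).
  by move=> Gx /(Gs (-1)); rewrite scaleN1r mulN1r; exact: GD.
have domG x : exists a, G (x, a).
  pose lower := [set a : R | exists2 y, G (y, a) & C (x - y)].
  pose upper := [set a : R | exists2 y, G (y, a) & C (y - x)].
  have low_up a b : lower a -> upper b -> a <= b.
    move=> [y Gy xy] [z Gz zx]; rewrite -subr_ge0.
    have /= := pG _ (GB _ _ _ _ Gz Gy); apply.
    by rewrite -(subrK x z) -addrA; exact: C_add.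
  have low0 : upper !=set0 -> lower !=set0.
    move=> [b [z Gz]] /C_dom [w Mw]; rewrite opprB addrCA.
    move=> wz; exists (b - f0 w); exists (z - w); last by rewrite opprB.
    exact: GB Gz (MG _ Mw).
  have up0 : lower !=set0 -> upper !=set0.
    move=> [b [z Gz]] /C_dom [w Mw]; rewrite opprB addrA.
    move=> wz; exists (f0 w + b); exists (w + z) => //.
    exact: GD (MG _ Mw) Gz.
  have [t lt ut] : exists2 t, ubound lower t & lbound upper t.
    have [ne|ne] := pselect (upper !=set0); last first.
      by exists 0 => a xa; [case: ne; apply: up0|case: ne]; exists a.
    have supl : has_sup lower.
      split; first exact: low0.
      by case: ne => b ub; exists b => a la; exact: low_up.
    exists (sup lower); first exact: sup_upper_bound.
    by move=> b ub; apply: ge_sup; [exact: low0|move=> a la; exact: low_up].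
  pose G' := [set u : V * R^o | exists y b c,
    [/\ G (y, b), u.1 = y + c *: x & u.2 = b + c * t]].
  have GG' : G `<=` G'.
    by move=> [y b] Gy; exists y, b, 0; rewrite /= scale0r mul0r !addr0.
  exists t; suff : G' `<=` G.
    by apply; exists 0, 0, 1; rewrite /= scale1r mul1r !add0r.
  apply: maxG => //; split.
  - move=> a [u1 u2] [v1 v2] [y [b [c [Gy /= -> ->]]]] [z [d [e [Gz /= -> ->]]]].
    exists (a *: y + z), (a * b + d), (a * c + e); split => /=.
    + exact: (lG a _ _ Gy Gz).
    + by rewrite scalerDr scalerA scalerDl addrACA.
    + by rewrite /GRing.scale /=; ring.
  - move=> [u v] [y [b [c [Gy /= -> ->]]]] Cy.
    (* Dividing by the absolute value of [c] compares [x] itself with a point of the domain: a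
       majorant if [c] is negative, a minorant if it is positive. *)
    have [c0|c0|c0] := ltgtP c 0.
    + have ut' : t <= (- c)^-1 * b.
        apply: ut; exists ((- c)^-1 *: y); first exact: Gs.
        have := @C_scale (- c)^-1 _ _ Cy; rewrite invr_ge0 oppr_ge0 ltW//.
        move=> /(_ isT); rewrite scalerDr scalerA invrN mulNr mulVf ?lt_eqF//.
        by rewrite scaleN1r.
      rewrite -(@ler_pM2l _ (- c)) ?oppr_gt0// in ut'.
      move: ut'; rewrite mulrA divff ?mul1r ?oppr_eq0 ?lt_eqF// mulNr.
      by rewrite lerNl -subr_ge0 opprK addrC.
    + have lt' : - (c^-1 * b) <= t.
        apply: lt; exists (- (c^-1 *: y)).
          by have := Gs (- c^-1) _ _ Gy; rewrite scaleNr mulNr.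
        have := @C_scale c^-1 _ _ Cy; rewrite invr_ge0 ltW//.
        move=> /(_ isT); rewrite scalerDr scalerA mulVf ?gt_eqF//.
        by rewrite scale1r opprK addrC.
      rewrite -(@ler_pM2l _ c)// in lt'.
      move: lt'; rewrite mulrN mulrA divff ?mul1r ?gt_eqF//.
      by rewrite lerNl -subr_ge0 opprK.
    + move: Cy; rewrite c0 scale0r mul0r !addr0.
      exact: (pG _ Gy).
  - move=> [u v] z [y [b [c [Gy /= -> ->]]]] Mz.
    exists (y + z), (b + f0 z), c; split => /=.
    + exact: GD (MG _ Mz).
    + by rewrite addrAC.
    + by rewrite addrAC.
have Guniq x a b : G (x, a) -> G (x, b) -> a <= b.
  move=> Ga /GB/(_ Ga) /pG; rewrite subrr /= subr_ge0; exact.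
have [f Gf] := choice domG.
have feq x a : G (x, a) -> f x = a.
  by move=> Ga; apply/eqP; rewrite eq_le !(Guniq x)//.
exists f; split=> [a x y|y My|x Cx].
- by apply: feq; exact: (lG a _ _ (Gf x) (Gf y)).
- by apply: feq; exact: MG.
- exact: (pG _ (Gf x)).
Qed.

End RieszExtension.

(** * Finite biorthogonal families in a vector space without a basis *)

Section DualFamily.
Variables (K : fieldType) (D : lmodType K).
Local Notation scalar f := (linear_for *%R (f : D -> K)).

Lemma scalar_sum (f : D -> K) : scalar f -> forall n (c : 'I_n -> K) (e : 'I_n -> D),
  f (\sum_i c i *: e i) = \sum_i c i * f (e i).
Proof.
move=> lf; have f0 : f 0 = 0.
  by have := lf (-1) 0 0; rewrite scaler0 addr0 mulN1r addNr.
elim=> [|n IH] c e; first by rewrite !big_ord0.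
by rewrite !big_ord_recl lf IH.
Qed.

(* Expanding h in the family e only after applying an arbitrary functional
   spares a Hamel basis of D. *)
Lemma dual_family (hs : seq D) :
  exists m (e : 'I_m -> D) (theta : 'I_m -> D -> K),
  [/\ forall k, scalar (theta k),
      forall k l, theta k (e l) = (k == l)%:R &
      forall h, h \in hs -> forall psi, scalar psi ->
        psi h = \sum_k theta k h * psi (e k)].
Proof.
elim: hs => [|h hs [m [e [theta [th_lin th_e th_hs]]]]].
  by exists 0, (fun=> 0), (fun _ _ => 0); split=> //; case.
pose r := h - \sum_k theta k h *: e k.
have psi_r psi : scalar psi -> psi r = psi h - \sum_k theta k h * psi (e k).
  move=> lpsi; rewrite /r -scaleN1r addrC lpsi mulN1r addrC.
  by rewrite (scalar_sum lpsi).
(* Either no functional sees the remainder [r], and the old family already serves [h], or [r]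
   becomes a new vector. *)
have [r0|] := pselect (forall psi, scalar psi -> psi r = 0).
  exists m, e, theta; split=> // h'; rewrite inE => /predU1P[->|] psi lpsi.
    by apply/eqP; rewrite -subr_eq0 -psi_r// r0.
  exact: th_hs.
move=> /existsNP[psi0 /not_implyP[lpsi0 /eqP r0]].
(* A Gram-Schmidt step on functionals: the correction makes [th'] vanish on the old vectors, the
   factor normalises it at [r]. *)
pose th' x := (psi0 r)^-1 * (psi0 x - \sum_k psi0 (e k) * theta k x).
have th'_lin : scalar th'.
  move=> a x y; rewrite /th' lpsi0.
  have -> : \sum_k psi0 (e k) * theta k (a *: x + y) =
      a * (\sum_k psi0 (e k) * theta k x) + \sum_k psi0 (e k) * theta k y.
    rewrite mulr_sumr -big_split /=; apply: eq_bigr => k _.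
    by rewrite th_lin; ring.
  ring.
have th'_e k : th' (e k) = 0.
  rewrite /th' (bigD1 k)//= th_e eqxx mulr1 big1 ?addr0 ?subrr ?mulr0//.
  by move=> l /negPf lk; rewrite th_e lk mulr0.
have th_r k : theta k r = 0.
  rewrite psi_r// (bigD1 k)//= th_e eqxx mulr1 big1 ?addr0 ?subrr//.
  by move=> l /negPf lk; rewrite th_e eq_sym lk mulr0.
have th'_r : th' r = 1.
  by rewrite /th' big1 ?subr0 ?mulVf// => k _; rewrite th_r mulr0.
have th'_h : th' h = 1.
  move: th'_r; rewrite psi_r// big1 ?subr0// => k _.
  by rewrite th'_e mulr0.
exists m.+1, (fun i => if unlift ord0 i is Some k then e k else r),
  (fun i => if unlift ord0 i is Some k then theta k else th').
split.
- by move=> i; case: unliftP.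
- move=> i j; case: (unliftP ord0 i) => [k|] ->; case: (unliftP ord0 j) => [l|] ->.
  + by rewrite th_e (inj_eq lift_inj).
  + by rewrite th_r eq_sym (negPf (neq_lift _ _)).
  + by rewrite th'_e (negPf (neq_lift _ _)).
  + by rewrite th'_r eqxx.
- move=> h' h'hs psi lpsi; rewrite big_ord_recl unlift_none.
  under eq_bigr do rewrite liftK.
  move: h'hs; rewrite inE => /predU1P[->|h'hs].
    by rewrite th'_h mul1r psi_r// subrK.
  rewrite (th_hs _ h'hs _ th'_lin) big1 ?mul0r ?add0r; last first.
    by move=> k _; rewrite th'_e mulr0.
  exact: th_hs.
Qed.

End DualFamily.

(** * Formal combinations and squares *)

Section ComplexParts.
Variable R : realType.
Local Notation Re := (@complex.Re R).
Local Notation Im := (@complex.Im R).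
Implicit Types x y : R[i].

Lemma reD x y : Re (x + y) = Re x + Re y. Proof. by case: x y => [a b] [c d]. Qed.
Lemma imD x y : Im (x + y) = Im x + Im y. Proof. by case: x y => [a b] [c d]. Qed.
Lemma reN x : Re (- x) = - Re x. Proof. by case: x. Qed.
Lemma reM x y : Re (x * y) = Re x * Re y - Im x * Im y.
Proof. by case: x y => [a b] [c d]. Qed.
Lemma imM x y : Im (x * y) = Re x * Im y + Im x * Re y.
Proof. by case: x y => [a b] [c d]. Qed.
Lemma reJ x : Re (Num.conj x) = Re x. Proof. by case: x. Qed.
Lemma imJ x : Im (Num.conj x) = - Im x. Proof. by case: x. Qed.
Lemma ReIm_eq x y : Re x = Re y -> Im x = Im y -> x = y.
Proof. by case: x y => [a b] [c d] /= -> ->. Qed.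
Lemma re_sum I (r : seq I) (P : pred I) (F : I -> R[i]) :
  Re (\sum_(i <- r | P i) F i) = \sum_(i <- r | P i) Re (F i).
Proof. exact: (big_morph Re reD). Qed.
Lemma im_sum I (r : seq I) (P : pred I) (F : I -> R[i]) :
  Im (\sum_(i <- r | P i) F i) = \sum_(i <- r | P i) Im (F i).
Proof. exact: (big_morph Im imD). Qed.
Lemma ge0_ReIm x : (0 <= x) = (Im x == 0) && (0 <= Re x). Proof. by case: x. Qed.

End ComplexParts.

Section SformFacts.
Variables (R : realType) (D : lmodType R[i]).
Implicit Types phi : sform D.

Definition mk_sform (u : D -> D -> R[i]) (Hu : bilinear_for
    ( *%R : GRing.Scale.law _ _) (Num.conj \; *%R : GRing.Scale.law _ _) u) :
    sform D :=
  HB.pack_for (sform D) u (bilinear_isBilinear.Build _ _ _ _ _ _ _ Hu).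

Lemma sform0l phi g : phi 0 g = 0. Proof. exact: (linear0l phi g). Qed.
Lemma sform0r phi f : phi f 0 = 0. Proof. exact: (linear0r phi f). Qed.
Lemma sformDl phi f f' g : phi (f + f') g = phi f g + phi f' g.
Proof. by have := sformPl phi 1 f f' g; rewrite scale1r mul1r. Qed.
Lemma sformDr phi f g g' : phi f (g + g') = phi f g + phi f g'.
Proof. by have := sformPr phi 1 f g g'; rewrite scale1r rmorph1 mul1r. Qed.
Lemma sformZl phi c f g : phi (c *: f) g = c * phi f g.
Proof. by have := sformPl phi c f 0 g; rewrite addr0 sform0l addr0. Qed.
Lemma sformZr phi c f g : phi f (c *: g) = Num.conj c * phi f g.
Proof. by have := sformPr phi c f g 0; rewrite addr0 sform0r addr0. Qed.
Lemma sformNl phi f g : phi (- f) g = - phi f g.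
Proof. by rewrite -scaleN1r sformZl mulN1r. Qed.
Lemma sformNr phi f g : phi f (- g) = - phi f g.
Proof. by rewrite -scaleN1r sformZr rmorphN1 mulN1r. Qed.
Lemma sform_suml phi n (f : 'I_n -> D) g : phi (\sum_i f i) g = \sum_i phi (f i) g.
Proof.
exact: (big_morph (fun f => phi f g) (fun a b => sformDl phi a b g) (sform0l phi g)).
Qed.
End SformFacts.

Section Transfer.
Variables (R : realType) (S : starMonoidType).
Implicit Types (Y : set (character R S)).

Lemma determiningT Y : determining Y -> determining [set: character R S].
Proof.
move=> [_ dY]; split=> [|n s c s_inj c0]; first by exists point.
apply: (dY _ s) => //; apply/funext => chi; rewrite fct_sumE.
have /(congr1 (fun f => f (SigSub (mem_set (I : setT (set_val chi)))))) := c0.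
by rewrite fct_sumE.
Qed.

(** Once the coefficients of equal points [s i] are merged, independence on [Y] makes each of them
    zero. This carries identities from [Y] to arbitrary characters and to values of form-valued
    maps. *)
Lemma determining_formal Y (I : eqType) (r : seq I) (c : I -> R[i]) (s : I -> S) :
  determining Y ->
  (forall chi, Y chi -> \sum_(i <- r) c i * chi (s i) = 0) ->
  forall (V : lmodType R[i]) (G : S -> V), \sum_(i <- r) c i *: G (s i) = 0.
Proof.
move=> [_ dY] c0 V G.
pose U := undup (map s r); pose d u := \sum_(i <- r | s i == u) c i.
have collect (W : lmodType R[i]) (F : S -> W) :
    \sum_(i <- r) c i *: F (s i) =
    \sum_(j < size U) d (nth 1%g U j) *: F (nth 1%g U j).
  rewrite -(big_mkord xpredT (fun j => d (nth 1%g U j) *: F (nth 1%g U j))).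
  rewrite -(big_nth 1%g xpredT (fun u => d u *: F u)).
  under [RHS]eq_bigr do rewrite scaler_suml big_mkcond.
  rewrite exchange_big [LHS]big_seq [RHS]big_seq /=; apply: eq_bigr => i ir.
  rewrite (bigD1_seq (s i)) ?undup_uniq ?mem_undup ?map_f//= eqxx.
  by rewrite big1 ?addr0// => u /negPf; rewrite eq_sym => ->.
rewrite collect big1// => j _.
rewrite (dY _ (fun j : 'I_(size U) => nth 1%g U j) (fun j => d (nth 1%g U j))).
- by rewrite scale0r.
- by move=> i k /eqP; rewrite nth_uniq ?undup_uniq// => /eqP/val_inj.
apply/funext => chi; rewrite fct_sumE.
have := collect R[i]^o (set_val chi); rewrite c0; last exact/set_mem/valP.
by move/esym.
Qed.

End Transfer.

Section FiniteSupport.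
Variable R : realType.
Implicit Types (u x y : nat -> R[i]).

Lemma cvg_series_fin_support u N : (forall n, (N <= n)%N -> u n = 0) ->
  series (u : nat -> R[i]^o) @ \oo --> (\sum_(i < N) u i : R[i]^o).
Proof.
move=> u0; apply: cvg_near_cst; near=> n.
have Nn : (N <= n)%N by near: n; exists N.
rewrite /series /= (big_cat_nat _ Nn)//= big_mkord [X in _ + X]big_nat_cond.
by rewrite [X in _ + X]big1 ?addr0// => i /andP[/andP[Ni _] _]; exact: u0.
Unshelve. all: by end_near. Qed.

Lemma ell2_fin_support x N : (forall n, (N <= n)%N -> x n = 0) -> ell2 x.
Proof.
move=> x0; apply/cvg_ex; exists (\sum_(i < N) `|x i| ^+ 2).
by apply: cvg_series_fin_support => n /x0 ->; rewrite normr0 expr0n.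
Qed.

Lemma ell2_dot_fin_support x y N : (forall n, (N <= n)%N -> x n = 0) ->
  ell2_dot x y = \sum_(i < N) x i * Num.conj (y i).
Proof.
move=> x0; rewrite /ell2_dot; apply/(@cvg_lim R[i]^o) => //.
by apply: cvg_series_fin_support => n /x0 ->; rewrite mul0r.
Qed.

End FiniteSupport.

Section FormalSquares.
Variables (R : realType) (S : starMonoidType).

Definition square_pairs (A : Type) (V : seq (seq A)) : seq (A * A) :=
  flatten [seq [seq (x, y) | x <- v, y <- v] | v <- V].

Lemma big_square_pairs (W : nmodType) (A : Type) (V : seq (seq A)) (F : A -> A -> W) :
  \sum_(q <- square_pairs V) F q.1 q.2 =
  \sum_(v <- V) \sum_(x <- v) \sum_(y <- v) F x y.
Proof.
rewrite /square_pairs big_flatten big_map; apply: eq_bigr => v _.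
by rewrite big_allpairs.
Qed.

Variables (D : lmodType R[i]) (T : set S) (Y : set (character R S)).

Lemma polyT_sumE n (c : 'I_n -> R[i]) (s : 'I_n -> T) (chi : Y) :
  (\sum_i c i *: hatT Y (s i)) chi = \sum_i c i * set_val chi (set_val (s i)).
Proof.
have -> : polyT_fun (\sum_i c i *: hatT Y (s i)) =
  \sum_i c i *: hat Y (set_val (s i)) by exact: (raddf_sum val).
by rewrite fct_sumE.
Qed.

Variables (Phi : T -> sform D) (Psi0 : S -> sform D).
Hypotheses (Psi0E : forall s : T, Psi0 (set_val s) = Phi s)
  (Y_det : determining Y).

(** The points [s i] may leave T, as products in a square do; their merged coefficients are then
    zero by independence, so any extension [Psi0] of [Phi] computes the value. *)
Lemma LambdaE (w : polyT T Y) (I : eqType) (r : seq I) (c : I -> R[i])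
    (s : I -> S) :
  (forall chi : Y, w chi = \sum_(i <- r) c i * set_val chi (s i)) ->
  Lambda Y Phi w = \sum_(i <- r) c i *: Psi0 (s i).
Proof.
have [n [d [t ->]]] := polyT_rep w => wE.
rewrite (Lambda_spec_sum _ _ (LambdaP Phi Y_det)).
under eq_bigr do rewrite -Psi0E.
pose r' : seq ('I_n + I) := map inl (index_enum 'I_n) ++ map inr r.
pose c' i := match i with inl j => d j | inr i => - c i end.
pose s' i := match i with inl j => set_val (t j) | inr i => s i end.
have sum' (V : lmodType R[i]) (G : S -> V) : \sum_(i <- r') c' i *: G (s' i) =
    \sum_j d j *: G (set_val (t j)) - \sum_(i <- r) c i *: G (s i).
  rewrite big_cat !big_map /= -sumrN; congr (_ + _).
  by apply: eq_bigr => i _; rewrite scaleNr.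
apply/eqP; rewrite -subr_eq0 -sum'; apply/eqP.
apply: (determining_formal Y_det) => chi Ychi.
have := wE (SigSub (mem_set Ychi)).
rewrite polyT_sumE => wchi; have -> := sum' R[i]^o chi.
by rewrite -wchi subrr.
Qed.

Hypothesis Phi_cfp : completely_f_positive (Lambda Y Phi).

(* The (k, l) sum over square_pairs V is <<p_k, p_l>>, where the coordinate of
   p_k at the block v of V is the sum of x.2 k * hat x.1 over x in v. *)
Lemma cfp_squares m (V : seq (seq (S * ('I_m -> R[i])))) (e : 'I_m -> D) :
  (0 < m)%N ->
  (forall k l, exists w : polyT T Y, forall chi : Y, w chi =
     \sum_(q <- square_pairs V)
       q.1.2 k * Num.conj (q.2.2 l) * set_val chi (q.2.1^-1 * q.1.1)%g) ->
  0 <= \sum_k \sum_l \sum_(q <- square_pairs V)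
       q.1.2 k * Num.conj (q.2.2 l) * Psi0 (q.2.1^-1 * q.1.1)%g (e k) (e l).
Proof.
move=> m0 HW; have [W WE] := choice (fun kl : 'I_m * 'I_m => HW kl.1 kl.2).
have /(_ m0) := @Phi_cfp m (\matrix_(k, l) W (k, l)).
have fW : f_polymx (\matrix_(k, l) W (k, l)).
  pose p k (chi : Y) n := \sum_(x <- nth [::] V n) x.2 k * set_val chi x.1.
  exists p; split=> [k|k l chi].
    exists (undup (map fst (flatten V))),
      (* [ell2_poly] wants one coefficient sequence per element of S, so the entries of block [n]
         sharing the point [u] are merged. *)
      (fun u n => \sum_(x <- nth [::] V n | x.1 == u) x.2 k); split.
    - exact: undup_uniq.
    - move=> u; apply: (@ell2_fin_support _ _ (size V)) => n Vn.
      by rewrite nth_default// big_nil.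
    - move=> u; rewrite mem_undup => Vu; apply/funext => n.
      rewrite big_seq_cond big1// => x /andP[xV /eqP xu].
      case/negP: Vu; apply/mapP; exists x => //; apply/flattenP.
      exists (nth [::] V n) => //; rewrite mem_nth// ltnNge.
      by apply: contraTN xV => Vn; rewrite nth_default.
    - apply/funext => chi; apply/funext => n; rewrite /p.
      under [RHS]eq_bigr do rewrite mulr_sumr big_mkcond.
      rewrite exchange_big /= [LHS]big_seq [RHS]big_seq.
      apply: eq_bigr => x xV; rewrite (bigD1_seq x.1) ?undup_uniq//=; last first.
        rewrite mem_undup; apply/mapP; exists x => //; apply/flattenP.
        exists (nth [::] V n) => //; rewrite mem_nth// ltnNge.
        by apply: contraTN xV => Vn; rewrite nth_default.
      rewrite eqxx big1 ?addr0 1?mulrC// => u /negPf.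
      by rewrite eq_sym => ->.
  rewrite mxE WE (ell2_dot_fin_support _ (N := size V)); last first.
    by move=> n Vn; rewrite /p nth_default// big_nil.
  rewrite (big_square_pairs _ (fun x y =>
    x.2 k * Num.conj (y.2 l) * set_val chi (y.1^-1 * x.1)%g)).
  rewrite (big_nth [::]) big_mkord; apply: eq_bigr => n _.
  rewrite rmorph_sum mulr_suml; apply: eq_bigr => x _.
  rewrite mulr_sumr; apply: eq_bigr => y _.
  by rewrite charM charV rmorphM /=; ring.
move=> /(_ fW e); congr (0 <= _); apply: eq_bigr => k _; apply: eq_bigr => l _.
rewrite !mxE (LambdaE (WE (k, l))).
elim: (square_pairs V) => [|q s IH]; first by rewrite !big_nil.
by rewrite !big_cons sformDE IH sformZE.
Qed.

End FormalSquares.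

(** * From complete f-positivity to a positive definite extension *)

Section PositiveExtension.
Local Open Scope complex_scope.
Variables (R : realType) (S : starMonoidType) (D : lmodType R[i]).
Local Notation Re := (@complex.Re R).
Local Notation Im := (@complex.Im R).

Definition hermitian_map (Psi : S -> sform D) :=
  forall s h k, Psi (s^-1)%g h k = Num.conj (Psi s k h).

Local Notation Z := {Psi : S -> sform D | hermitian_map Psi}.

(* The real span of these functions plays the role of the self-adjoint part of
   the tensor product of C[S], D and the conjugate of D. *)
Definition ev (s : S) (h k : D) : Z -> R^o := fun Psi => Re (sval Psi s h k).

Lemma evP (a : R) s h h' k : ev s (a%:C *: h + h') k = a *: ev s h k + ev s h' k.
Proof.
by apply/funext => -[Psi ?]; rewrite /ev /= sformPl reD reM mul0r subr0.
Qed.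

Lemma evDl s h h' k : ev s (h + h') k = ev s h k + ev s h' k.
Proof. by apply/funext => -[Psi ?]; rewrite /ev /= sformDl reD. Qed.

Lemma evDr s h k k' : ev s h (k + k') = ev s h k + ev s h k'.
Proof. by apply/funext => -[Psi ?]; rewrite /ev /= sformDr reD. Qed.

Lemma evZl s a h k :
  ev s (a *: h) k = Re a *: ev s h k + Im a *: ev s ('i *: h) k.
Proof.
apply/funext => P.
change (ev s (a *: h) k P = Re a * ev s h k P + Im a * ev s ('i%C *: h) k P).
have evZ b : ev s (b *: h) k P = Re (b * sval P s h k) by rewrite /ev sformZl.
by rewrite !evZ !reM /= mul0r mul1r sub0r mulrN.
Qed.

Lemma evZr s a h k : ev s h (a *: k) = ev s (Num.conj a *: h) k.
Proof. by apply/funext => -[Psi ?]; rewrite /ev /= sformZl sformZr. Qed.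

Lemma evNl s h k : ev s (- h) k = - ev s h k.
Proof. by apply/funext => P; rewrite /ev !fctE sformNl reN. Qed.

Lemma evNr s h k : ev s h (- k) = - ev s h k.
Proof. by apply/funext => P; rewrite /ev !fctE sformNr reN. Qed.

Definition ev_square (v : seq (S * D)) : Z -> R^o :=
  \sum_(x <- v) \sum_(y <- v) ev (y.1^-1 * x.1)%g x.2 y.2.

Definition square_cone : set (Z -> R^o) :=
  [set x | exists V, x = \sum_(v <- V) ev_square v].

(** Coefficients can be omitted: a real factor is absorbed by the first vector of a term. *)
Definition ev_span (T : set S) : set (Z -> R^o) :=
  [set x | exists2 l : seq (S * D * D), (forall t, t \in l -> T t.1.1) &
     x = \sum_(t <- l) ev t.1.1 t.1.2 t.2].

Lemma ev_span0 T : ev_span T 0.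
Proof. by exists [::]; rewrite ?big_nil. Qed.

Lemma ev_span_ev (T : set S) s h k : T s -> ev_span T (ev s h k).
Proof.
move=> Ts; exists [:: (s, h, k)]; last by rewrite big_seq1.
by move=> t; rewrite inE => /eqP ->.
Qed.

Lemma ev_span_lin (T : set S) (a : R) x y :
  ev_span T x -> ev_span T y -> ev_span T (a *: x + y).
Proof.
move=> [l lT ->] [l' lT' ->].
exists ([seq (t.1.1, a%:C *: t.1.2, t.2) | t <- l] ++ l').
  by move=> t; rewrite mem_cat => /orP[/mapP[u /lT Tu ->]|/lT'].
rewrite big_cat big_map scaler_sumr; congr (_ + _); apply: eq_bigr => t _ /=.
by rewrite -[_ *: t.1.2]addr0 evP -[X in _ + ev _ X _](scale0r 0) evZl !scale0r !addr0.
Qed.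

Lemma square_cone0 : square_cone 0.
Proof. by exists [::]; rewrite big_nil. Qed.

Lemma square_coneD x y : square_cone x -> square_cone y -> square_cone (x + y).
Proof. by move=> [V ->] [W ->]; exists (V ++ W); rewrite big_cat. Qed.

Lemma ev_square_scale (a : R) v :
  ev_square [seq (x.1, a%:C *: x.2) | x <- v] = (a ^+ 2) *: ev_square v.
Proof.
rewrite /ev_square big_map scaler_sumr; apply: eq_bigr => x _.
rewrite big_map scaler_sumr; apply: eq_bigr => y _ /=.
apply/funext => P.
change (ev (y.1^-1 * x.1)%g (a%:C *: x.2) (a%:C *: y.2) P =
  a ^+ 2 * ev (y.1^-1 * x.1)%g x.2 y.2 P).
rewrite /ev (sformZl (sval P _)) (sformZr (sval P _)) !reM /=.
by move: (complex.Re _) (complex.Im _) => b c; ring.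
Qed.

Lemma square_coneZ (a : R) x : 0 <= a -> square_cone x -> square_cone (a *: x).
Proof.
move=> a0 [V ->].
exists [seq [seq (x.1, (Num.sqrt a)%:C *: x.2) | x <- v] | v <- V].
rewrite big_map scaler_sumr; apply: eq_bigr => v _.
by rewrite ev_square_scale sqr_sqrtr.
Qed.

Lemma square_cone_sq v : square_cone (ev_square v).
Proof. by exists [:: v]; rewrite big_seq1. Qed.

(** Induction by the parallelogram law: the squares of x + v and x - v add up to twice the square of
    x plus twice that of v. The square of the single term x sits at a Hermitian point, hence in
    T. *)
Lemma ev_square_dom (T : set S) v : [set s : S | s = (s^-1)%g] `<=` T ->
  exists2 y, ev_span T y & square_cone (y - ev_square v).
Proof.
move=> hT; elim: v => [|x v [y yT yC]].
  exists 0; first exact: ev_span0.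
  by rewrite /ev_square big_nil subr0; exact: square_cone0.
pose d := ev (x.1^-1 * x.1)%g x.2 x.2.
have dT : ev_span T d by apply: ev_span_ev; apply: hT; rewrite /= invgM invgK.
exists (2%:R *: d + 2%:R *: y).
  by apply: ev_span_lin dT _; rewrite -[X in ev_span _ X]addr0;
    exact: ev_span_lin yT (ev_span0 _).
pose v' := [seq (z.1, - z.2) | z <- v].
have -> : 2%:R *: d + 2%:R *: y - ev_square (x :: v) =
    2%:R *: (y - ev_square v) + ev_square (x :: v').
  rewrite /ev_square !big_cons.
  under [X in _ - (_ + X)]eq_bigr do rewrite big_cons.
  under [X in _ + (_ + X)]eq_bigr do rewrite big_cons.
  rewrite !big_split !big_map /=.
  under [X in _ + (_ + X + _)]eq_bigr do rewrite evNr.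
  under [X in _ + (_ + (X + _))]eq_bigr do rewrite evNl.
  under [X in _ + (_ + (_ + X))]eq_bigr => z _.
    rewrite big_map; under eq_bigr do rewrite evNr evNl opprK.
    over.
  rewrite !sumrN.
  set a := \sum_(z <- v) ev _ x.2 _; set b := \sum_(z <- v) ev _ _ x.2.
  set c := \sum_(z <- v) _.
  apply/funext => P; rewrite !fctE /= /GRing.scale /=; ring.
by apply: square_coneD; [exact: square_coneZ|exact: square_cone_sq].
Qed.

Lemma square_cone_dom (T : set S) x : [set s : S | s = (s^-1)%g] `<=` T ->
  square_cone x -> exists2 y, ev_span T y & square_cone (y - x).
Proof.
move=> hT [V ->]; elim: V => [|v V [y yT yC]].
  by exists 0; [exact: ev_span0|rewrite big_nil subr0; exact: square_cone0].
have [z zT zC] := ev_square_dom v hT; exists (z + y).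
  by rewrite -[z]scale1r; exact: ev_span_lin.
by rewrite big_cons opprD addrACA; exact: square_coneD.
Qed.

End PositiveExtension.

Section PolyTSpan.
Variables (R : realType) (S : starMonoidType).
Variables (T : set S) (Y : set (character R S)).

Definition in_polyT (u : Y -> R[i]) := exists w : polyT T Y, forall chi, w chi = u chi.

Lemma in_polyT_lin a u v : in_polyT u -> in_polyT v ->
  in_polyT (fun chi => a * u chi + v chi).
Proof.
by move=> [w wu] [w' wv]; exists (a *: w + w') => chi; rewrite -wu -wv.
Qed.

Lemma in_polyT_hat s : T s -> in_polyT (fun chi => set_val chi s).
Proof. by move=> Ts; exists (hatT Y (SigSub (mem_set Ts))). Qed.

Lemma in_polyT_sum (I : eqType) (r : seq I) (c : I -> R[i]) (s : I -> S) :
  (forall i, i \in r -> T (s i)) ->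
  in_polyT (fun chi => \sum_(i <- r) c i * set_val chi (s i)).
Proof.
elim: r => [|i r IH] rT; first by exists 0 => chi; rewrite big_nil.
have [w wE] := in_polyT_lin (c i) (in_polyT_hat (rT i (mem_head _ _)))
  (IH (fun j jr => rT j (@mem_behead _ (i :: r) j jr))).
by exists w => chi; rewrite wE big_cons.
Qed.

End PolyTSpan.

Lemma sum_evalE (R : realType) (Z I : Type) (r : seq I) (F : I -> Z -> R^o) z :
  (\sum_(i <- r) F i) z = \sum_(i <- r) (F i z : R) :> R.
Proof. by rewrite fct_sumE. Qed.

Section TestForm.
Variables (R : realType) (S : starMonoidType) (D : lmodType R[i]).
Variables (th th' : D -> R[i]) (lam : R[i]).
Hypotheses (th_lin : linear_for *%R th) (th'_lin : linear_for *%R th').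

Lemma test_form_bilinear :
  bilinear_for ( *%R : GRing.Scale.law _ _) (Num.conj \; *%R : GRing.Scale.law _ _)
    (fun h h' => lam * th h * Num.conj (th' h') +
                 Num.conj lam * Num.conj (th h') * th' h).
Proof.
split=> [g c f f'|f c g g'] /=; rewrite !(th_lin, th'_lin).
  by ring.
by rewrite !rmorphD !rmorphM; ring.
Qed.

(** The product of [th] and the conjugate of [th'], scaled by [lam], plus its adjoint. Multiplied by
    a character it is a Hermitian map, that is, a point at which the functions [ev] can be
    evaluated. *)
Definition test_form := mk_sform test_form_bilinear.

Lemma test_formE h h' : test_form h h' = lam * th h * Num.conj (th' h') +
  Num.conj lam * Num.conj (th h') * th' h.
Proof. by []. Qed.

Lemma test_map_hermitian (chi : character R S) :
  hermitian_map (fun s => chi s *: test_form).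
Proof.
move=> s h k; rewrite (sformZE _ test_form) (sformZE _ test_form) charV rmorphM.
congr (_ * _).
by rewrite test_formE test_formE rmorphD !rmorphM /= !conjCK addrC mulrAC
  [X in _ + X]mulrAC.
Qed.

End TestForm.

Section CompletelyFPositiveExtends.
Local Open Scope complex_scope.
Variables (R : realType) (S : starMonoidType) (T : set S).
Hypotheses (T_inv : forall s, T s -> T (s^-1)%g)
  (T_herm : [set s : S | s = (s^-1)%g] `<=` T).
Variables (Y : set (character R S)) (D : lmodType R[i]) (Phi : T -> sform D).
Hypotheses (Y_det : determining Y) (Phi_cfp : completely_f_positive (Lambda Y Phi)).
Local Notation Re := (@complex.Re R).
Local Notation Im := (@complex.Im R).

(** Zero outside T is compatible with Hermitian symmetry, because T is symmetric. *)
Let Psi0 (s : S) : sform D :=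
  if pselect (T s) is left Ts then Phi (SigSub (mem_set Ts)) else 0.

Let Psi0E (s : T) : Psi0 (set_val s) = Phi s.
Proof.
rewrite /Psi0; case: pselect => [Ts|/(_ (set_mem (valP s)))//].
by congr Phi; exact: val_inj.
Qed.

Let T_1 : T 1%g. Proof. by apply: T_herm; rewrite /= invg1. Qed.
Let T_sq s : T (s^-1 * s)%g. Proof. by apply: T_herm; rewrite /= invgM invgK. Qed.

(** The square of the formal element with terms (s, h) and (1, k): its four points are s^* s, s, s^*
    and 1, all in T, so f-positivity applies to it. *)
Let pair_ge0 s h k : T s -> 0 <= Psi0 (s^-1 * s)%g h h + Psi0 s h k
  + Psi0 (s^-1)%g k h + Psi0 1%g k k.
Proof.
move=> Ts.
pose V : seq (seq (S * ('I_2 -> R[i]))) :=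
  [:: [:: (s, fun i => (i == ord0)%:R); (1%g, fun i => (i == ord_max)%:R)]].
pose e (i : 'I_2) := if i == ord0 then h else k.
have := @cfp_squares R S D T Y Phi Psi0 Psi0E Y_det Phi_cfp 2 V e isT.
have H k' l' : in_polyT T (fun chi : Y => \sum_(q <- square_pairs V)
    q.1.2 k' * Num.conj (q.2.2 l') * set_val chi (q.2.1^-1 * q.1.1)%g).
  apply: in_polyT_sum => q; rewrite /square_pairs /= !inE.
  by move=> /or4P[] /eqP -> /=; rewrite ?invg1 ?mul1g ?mulg1//; exact: T_inv.
move=> /(_ H).
rewrite !big_ord_recr !big_ord0 /= /square_pairs /= !big_cons !big_nil /=.
rewrite !(mulr0,mul0r,rmorph1,rmorph0,mulr1,mul1r,add0r,addr0) /= ?invg1 ?mul1g ?mulg1.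
by congr (0 <= _); rewrite /e /=; ring.
Qed.

Let Psi0_herm : hermitian_map Psi0.
Proof.
move=> s h k; have [Ts|Ts] := pselect (T s); last first.
  have Tsi : ~ T (s^-1)%g by move=> /T_inv; rewrite invgK.
  rewrite /Psi0; case: pselect => // _; case: pselect => // _.
  by rewrite /= rmorph0.
have im_diag h' : Im (Psi0 (s^-1 * s)%g h' h') = 0.
  have := pair_ge0 h' 0 Ts; rewrite !(sform0r, sform0l) !addr0.
  by rewrite ge0_ReIm => /andP[/eqP].
have Im_1 k' : Im (Psi0 1%g k' k') = 0.
  have := pair_ge0 0 k' Ts; rewrite !(sform0r, sform0l) !add0r.
  by rewrite ge0_ReIm => /andP[/eqP].
have Im0 h' k' : Im (Psi0 s h' k') + Im (Psi0 (s^-1)%g k' h') = 0.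
  have := pair_ge0 h' k' Ts; rewrite ge0_ReIm => /andP[/eqP + _].
  by rewrite !imD im_diag Im_1 add0r addr0.
apply: ReIm_eq; rewrite ?reJ ?imJ.
  (* Multiplying [k] by i turns the relation between imaginary parts into the one between real
     parts. *)
  have := Im0 ('i%C *: k) h; rewrite sformZl sformZr !imM reJ imJ /=.
  lra.
by have := Im0 k h; lra.
Qed.

Let sesqui_expand m (e : 'I_m -> D) (th : 'I_m -> D -> R[i]) (phi : sform D) h h' :
  (forall psi : D -> R[i], linear_for *%R psi -> psi h = \sum_k th k h * psi (e k)) ->
  (forall psi : D -> R[i], linear_for *%R psi -> psi h' = \sum_k th k h' * psi (e k)) ->
  phi h h' = \sum_k \sum_l th k h * Num.conj (th l h') * phi (e k) (e l).
Proof.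
move=> eh eh'; rewrite (eh (phi^~ h')); last by move=> a f g; rewrite sformPl.
apply: eq_bigr => k _.
have -> : phi (e k) h' = Num.conj (\sum_l th l h' * Num.conj (phi (e k) (e l))).
  rewrite -(eh' (fun f => Num.conj (phi (e k) f))) => [|a f g].
    by rewrite conjCK.
  by rewrite sformPr rmorphD rmorphM; congr (_ * _ + _); exact: conjCK.
rewrite rmorph_sum mulr_sumr; apply: eq_bigr => l _.
by rewrite rmorphM /= conjCK mulrA.
Qed.

(** The positivity hypothesis of the Riesz extension. The squares in [V] may involve points outside
    T that cancel only in the total, so the work lies in showing that every entry of the associated
    Gram matrix is in P_T(Y). *)
Let square_cone_ge0 (x : _ -> R^o) :
  ev_span T x -> square_cone x -> 0 <= x (exist _ Psi0 Psi0_herm).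
Proof.
move=> [ts tsT xT] [V xV].
(* One family for all vectors of [V]: the squares acquire scalar coefficients [th k] and fixed
   vectors [e k], the shape required by [cfp_squares]. *)
have [m [e [th [th_lin _ th_e]]]] := dual_family (map snd (flatten V)).
have in_V v z : v \in V -> z \in v -> forall psi : D -> R[i], linear_for *%R psi ->
    psi z.2 = \sum_k th k z.2 * psi (e k).
  move=> vV zv; apply: th_e; apply/mapP; exists z => //.
  by apply/flattenP; exists v.
have -> : x (exist _ Psi0 Psi0_herm) = Re (\sum_k \sum_l \sum_(v <- V)
    \sum_(x <- v) \sum_(y <- v) th k x.2 * Num.conj (th l y.2) *
    Psi0 (y.1^-1 * x.1)%g (e k) (e l)) :> R.
  rewrite xV sum_evalE; apply/esym.
  under eq_bigr do rewrite exchange_big.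
  rewrite exchange_big /= re_sum; apply: eq_big_seq => v vV.
  under eq_bigr do rewrite exchange_big.
  rewrite exchange_big /= re_sum /ev_square sum_evalE; apply: eq_big_seq => z zv.
  under eq_bigr do rewrite exchange_big.
  rewrite exchange_big /= re_sum sum_evalE; apply: eq_big_seq => y yv.
  by rewrite /ev /= -(sesqui_expand _ (in_V _ _ vV zv) (in_V _ _ vV yv)).
have [m0|m0] := posnP m; first by rewrite big1// => -[k km]; have := km; rewrite {1}m0.
pose W : seq (seq (S * ('I_m -> R[i]))) :=
  [seq [seq (z.1, fun k => th k z.2) | z <- v] | v <- V].
have sumW (A : nmodType) (F : S * ('I_m -> R[i]) -> S * ('I_m -> R[i]) -> A) :
    \sum_(q <- square_pairs W) F q.1 q.2 = \sum_(v <- V) \sum_(x <- v) \sum_(y <- v)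
      F (x.1, fun k => th k x.2) (y.1, fun k => th k y.2).
  rewrite big_square_pairs big_map; apply: eq_bigr => v _.
  rewrite big_map; apply: eq_bigr => z _.
  by rewrite big_map.
have := @cfp_squares R S D T Y Phi Psi0 Psi0E Y_det Phi_cfp m W e m0.
suff H k l : in_polyT T (fun chi : Y => \sum_(q <- square_pairs W)
    q.1.2 k * Num.conj (q.2.2 l) * set_val chi (q.2.1^-1 * q.1.1)%g).
  move=> /(_ H); rewrite ge0_ReIm => /andP[_].
  congr (0 <= Re _); apply: eq_bigr => k _; apply: eq_bigr => l _.
  exact: (sumW _ (fun x y => x.2 k * Num.conj (y.2 l) * Psi0 (y.1^-1 * x.1)%g _ _)).
(* At a test map, a term of [ts] contributes through the rank-one form and through its adjoint,
   whence coefficients at s and at s^*. A sum of squares is self-adjoint and contributes the same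
   real part twice, whence the halves. *)
pose z1 (t : S * D * D) := th k t.1.2 * Num.conj (th l t.2) / 2.
pose z2 (t : S * D * D) := th k t.2 * Num.conj (th l t.1.2) / 2.
have [w1 w1E] := in_polyT_sum (r := ts) Y z1 (s := fun t => t.1.1) tsT.
have [w2 w2E] := in_polyT_sum (r := ts) Y z2 (s := fun t => (t.1.1)^-1%g)
  (fun t tts => T_inv (tsT t tts)).
exists (w1 + w2) => chi.
transitivity (w1 chi + w2 chi) => //; rewrite w1E w2E.
rewrite (sumW _ (fun x y => x.2 k * Num.conj (y.2 l) * set_val chi (y.1^-1 * x.1)%g)) /=.
set a := \sum_(t <- ts) _; set b := \sum_(t <- ts) _; set c := \sum_(v <- V) _.
(* The functions [ev] record real parts only; [lam] equal to 1 and to i yields the two components of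
   a + b = c. *)
have main lam : Re (lam * (a + b)) = Re (lam * c).
  pose P := exist _ _ (test_map_hermitian lam (th_lin k) (th_lin l) (set_val chi)).
  have evE s f g : ev s f g P =
      Re (set_val chi s * test_form lam (th_lin k) (th_lin l) f g) :> R.
    by rewrite /ev -sformZE.
  have half z : Re z / 2 = Re (z / 2) by rewrite {1}(splitr z) reD; field.
  have -> : Re (lam * (a + b)) = x P / 2.
    rewrite xT sum_evalE mulrDr reD !mulr_sumr !re_sum -big_split mulr_suml.
    apply: eq_bigr => t _; rewrite evE test_formE mulrDr reD charV /z1 /z2.
    rewrite mulrDl !half; congr (_ + _); first by congr Re; ring.
    rewrite -reJ !(rmorphM, fmorphV) /= conjC_nat !conjCK.
    by congr Re; ring.
  rewrite xV sum_evalE.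
  have -> : lam * c = \sum_(v <- V) \sum_(x <- v) \sum_(y <- v) (lam *
      (th k x.2 * Num.conj (th l y.2) * set_val chi (y.1^-1 * x.1)%g)).
    rewrite mulr_sumr; apply: eq_bigr => v _; rewrite mulr_sumr.
    by apply: eq_bigr => z _; rewrite mulr_sumr.
  rewrite re_sum mulr_suml; apply: eq_bigr => v _; rewrite /ev_square sum_evalE.
  have -> : \sum_(x <- v) (\sum_(y <- v) ev (y.1^-1 * x.1)%g x.2 y.2) P =
      \sum_(x <- v) \sum_(y <- v) Re (lam * (th k x.2 * Num.conj (th l y.2) *
         set_val chi (y.1^-1 * x.1)%g)) +
      \sum_(x <- v) \sum_(y <- v) Re (lam * (th k y.2 * Num.conj (th l x.2) *
         set_val chi (x.1^-1 * y.1)%g)) :> R.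
    rewrite -big_split; apply: eq_bigr => z _.
    rewrite -big_split sum_evalE; apply: eq_bigr => y _.
    rewrite evE test_formE mulrDr reD; congr (_ + _); first by congr Re; ring.
    rewrite -reJ !rmorphM /= !conjCK -charV invgM invgK.
    by congr Re; ring.
  rewrite [X in _ + X]exchange_big /= mulrDl -splitr.
  by rewrite re_sum; apply: eq_bigr => z _; rewrite re_sum.
apply: ReIm_eq; first by have := main 1; rewrite !mul1r.
by have := main 'i%C; rewrite !reM /= !mul0r !mul1r !sub0r => /oppr_inj.
Qed.

(** The functional being extended is evaluation at [P0]; on [ev s h k] with [s] in T it returns the
    real part of [Phi]. *)
Theorem cfp_extends : exists Psi : S -> sform D,
  positive_definite Psi /\ forall s : T, Psi (set_val s) = Phi s.
Proof.
pose P0 := exist _ Psi0 Psi0_herm.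
have [f [f_lin fT fC]] := @riesz_extension R _ (ev_span T) (@square_cone R S D)
  (fun x => x P0 : R^o) (fun a x y => erefl) (@ev_span0 R S D T) (@ev_span_lin R S D T)
  (@square_cone0 R S D) (@square_coneD R S D) (@square_coneZ R S D)
  (fun x => square_cone_dom T_herm) square_cone_ge0.
have f0 : f 0 = 0.
  by have := f_lin (-1) 0 0; rewrite scaler0 addr0 scaleN1r addNr.
have fD x y : f (x + y) = f x + f y by have := f_lin 1 x y; rewrite !scale1r.
have fZ (a : R) x : f (a *: x) = a * f x.
  by have := f_lin a x 0; rewrite f0 !addr0.
have f_sum I (r : seq I) (F : I -> _) : f (\sum_(i <- r) F i) = \sum_(i <- r) f (F i).
  exact: (big_morph f fD f0).
(* Complexification: Im z = Re(-i z), with the factor -i moved into the vector [h]. *)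
pose u s h k : R[i] := f (ev s h k) +i* f (ev s (- 'i%C *: h) k).
have uD s h h' k : u s (h + h') k = u s h k + u s h' k.
  by rewrite /u scalerDr !evDl !fD.
have uDr s h k k' : u s h (k + k') = u s h k + u s h k'.
  by rewrite /u !evDr !fD.
have uZ s a h k : u s (a *: h) k = a * u s h k.
  have iE b : ev s (b *: h) k = Re b *: ev s h k - Im b *: ev s (- 'i%C *: h) k.
    by rewrite evZl scaleNr evNl scalerN opprK.
  rewrite /u scalerA (iE a) (iE (- 'i%C * a)) -!scaleNr !fD !fZ.
  by case: a => a b; apply: ReIm_eq => /=; ring.
have uZr s a h k : u s h (a *: k) = Num.conj a * u s h k.
  by rewrite -uZ /u !evZr !scalerA mulrC.
have u_bilinear s : bilinear_for ( *%R : GRing.Scale.law _ _)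
    (Num.conj \; *%R : GRing.Scale.law _ _) (u s).
  by split=> [k a h h'|h a k k'] /=; rewrite ?uD ?uDr ?uZ ?uZr.
exists (fun s => mk_sform (u_bilinear s)); split=> [m s h m0|s].
  rewrite ge0_ReIm re_sum im_sum; apply/andP; split.
    under eq_bigr do rewrite im_sum -f_sum.
    rewrite -f_sum -[X in _ == X]f0; apply/eqP; congr f.
    apply/funext => -[Psi hPsi]; rewrite sum_evalE.
    under eq_bigr => i _.
      rewrite sum_evalE.
      under eq_bigr do rewrite /ev /= sformZl reM /= oppr0 mul0r sub0r mulN1r opprK.
      over.
    (* The argument of [f] is already the zero function: at a Hermitian map, exchanging the two
       indices changes the sign of the sum of imaginary parts. *)
    set s1 := LHS; suff s1N : s1 = - s1 by change (s1 = 0 :> R); lra.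
    rewrite {1}/s1 exchange_big -sumrN; apply: eq_bigr => i _.
    rewrite -sumrN; apply: eq_bigr => j _.
    by rewrite -imJ -hPsi invgM invgK.
  have : square_cone (ev_square [seq (s i, h i) | i <- index_enum 'I_m]).
    exact: square_cone_sq.
  move=> /fC; rewrite /ev_square big_map f_sum; congr (0 <= _).
  apply: eq_bigr => i _; rewrite big_map f_sum re_sum.
  by apply: eq_bigr.
apply: sformP => h k; rewrite -Psi0E.
have Ts : T (set_val s) by exact/set_mem/valP.
apply: ReIm_eq; rewrite /= fT; try exact: ev_span_ev.
  by [].
by rewrite /ev /= sformZl reM /= oppr0 mul0r sub0r mulN1r opprK.
Qed.

End CompletelyFPositiveExtends.

(** * From complete positivity to complete f-positivity *)

Section ComplexSeries.
Local Open Scope complex_scope.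
Variable R : realType.
Local Notation Re := (@complex.Re R).
Local Notation Im := (@complex.Im R).
Implicit Types (u v : nat -> R[i]^o) (z : R[i]).

Lemma normc_le_ReIm z : `|z| <= (`|Re z| + `|Im z|)%:C.
Proof.
rewrite {1}[z]complexE; apply: le_trans (ler_normD _ _) _.
have normRC (a : R) : `|a%:C| = `|a|%:C.
  by rewrite normc_def /= expr0n addr0 sqrtr_sqr.
rewrite normrM !normRC.
have -> : `|'i%C : R[i]| = 1.
  by rewrite normc_def /= expr0n expr1n add0r sqrtr1.
by rewrite mul1r rmorphD.
Qed.

Lemma normc_ge_Im z : `|Im z|%:C <= `|z|.
Proof.
have := normc_ge_Re (- 'i%C * z); rewrite normrM normrN.
have -> : `|'i%C : R[i]| = 1.
  by rewrite normc_def /= expr0n expr1n add0r sqrtr1.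
by rewrite mul1r reM /= oppr0 mul0r sub0r mulN1r opprK.
Qed.

Lemma cvg_complexP u z : u @ \oo --> (z : R[i]^o) <->
  (Re \o u) @ \oo --> Re z /\ (Im \o u) @ \oo --> Im z.
Proof.
split=> [uz|[uRe uIm]].
  split; apply/cvgrPdist_lt => e e0.
    have := (@cvgrPdist_lt _ _ _ _ _ _ _).1 uz e%:C; rewrite ltcR => /(_ _ e0).
    apply: filterS => n; rewrite -ltcR; apply: le_lt_trans.
    by rewrite /= -reN -reD; exact: normc_ge_Re.
  have := (@cvgrPdist_lt _ _ _ _ _ _ _).1 uz e%:C; rewrite ltcR => /(_ _ e0).
  apply: filterS => n; rewrite -ltcR; apply: le_lt_trans.
  have -> : Im z - (Im \o u) n = Im (z - u n) by rewrite imD /=; case: (u n).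
  exact: normc_ge_Im.
apply/cvgrPdist_lt => e; rewrite ltcE /= => /andP[/eqP e_real e0].
have eE : e = (Re e)%:C by case: e e_real {e0} => a b /= ->.
move: (Re e) e0 eE => d d0 ->.
have d2 : 0 < d / 2 by rewrite divr_gt0.
near=> n; apply: le_lt_trans (normc_le_ReIm _) _; rewrite ltcR [d]splitr.
apply: ltrD.
  rewrite reD reN; near: n.
  exact: ((@cvgrPdist_lt _ _ _ _ _ _ _).1 uRe).
have -> : Im (z - u n) = Im z - Im (u n) by rewrite imD; case: (u n).
near: n; exact: ((@cvgrPdist_lt _ _ _ _ _ _ _).1 uIm).
Unshelve. all: by end_near. Qed.

Lemma re_series u n : Re (series u n) = series (Re \o u) n.
Proof. exact: re_sum. Qed.

Lemma im_series u n : Im (series u n) = series (Im \o u) n.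
Proof. exact: im_sum. Qed.

Lemma is_cvg_series_complex u : cvgn (series (Re \o u)) ->
  cvgn (series (Im \o u)) -> cvgn (series u).
Proof.
move=> /cvg_ex[a ua] /cvg_ex[b ub]; apply/cvg_ex; exists (a +i* b).
apply/cvg_complexP; split.
  by have -> : Re \o series u = series (Re \o u) by apply/funext => n; exact: re_series.
by have -> : Im \o series u = series (Im \o u) by apply/funext => n; exact: im_series.
Qed.

Lemma lim_series_ge0 u : cvgn (series u) -> (forall n, 0 <= u n) ->
  0 <= (limn (series u) : R[i]).
Proof.
move=> cu u0; have /cvg_complexP[uRe uIm] : series u @ \oo --> limn (series u) by [].
rewrite ge0_ReIm; apply/andP; split.
  apply/eqP; rewrite -(cvg_lim _ uIm)//.
  have -> : Im \o series u = fun=> 0.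
    apply/funext => n; rewrite /= im_series /series /= big1// => i _.
    by have := u0 i; rewrite ge0_ReIm => /andP[/eqP].
  by rewrite lim_cst.
rewrite -(cvg_lim _ uRe)//; apply: limr_ge.
  by apply/cvg_ex; exists (Re (limn (series u))).
apply: nearW => n; rewrite /= re_series /series /= sumr_ge0// => i _.
by have := u0 i; rewrite ge0_ReIm => /andP[].
Qed.

Lemma cvg_series_comb (I : Type) (r : seq I) (a : I -> R[i]) (u : I -> nat -> R[i]^o) :
  (forall i, cvgn (series (u i))) ->
  series ((fun n => \sum_(i <- r) a i * u i n) : nat -> R[i]^o) @ \oo -->
    (\sum_(i <- r) a i * limn (series (u i)) : R[i]^o).
Proof.
move=> cu.
have -> : series ((fun n => \sum_(i <- r) a i * u i n) : nat -> R[i]^o) =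
    fun n => \sum_(i <- r) a i * series (u i) n.
  apply/funext => n; rewrite /series /= exchange_big /=.
  by apply: eq_bigr => i _; rewrite mulr_sumr.
elim: r => [|i r IH].
  under eq_fun do rewrite big_nil.
  by rewrite big_nil; exact: cvg_cst.
under eq_fun do rewrite big_cons.
rewrite big_cons; apply: (cvgD _ IH).
by apply: cvgM; [exact: cvg_cst|exact: cu].
Qed.

Lemma ell2_re (x : nat -> R[i]) : ell2 x ->
  cvgn (series (fun n => (Re (x n)) ^+ 2 + (Im (x n)) ^+ 2)).
Proof.
move=> /cvg_ex[l /cvg_complexP[+ _]] => xl; apply/cvg_ex; exists (Re l).
have <- : Re \o series ((fun n => `|x n| ^+ 2) : nat -> R[i]^o) =
    series (fun n => Re (x n) ^+ 2 + Im (x n) ^+ 2).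
  apply/funext => n; rewrite /= re_series; apply: eq_bigr => i _.
  by rewrite -[RHS]/(Re (_ %:C)) add_Re2_Im2.
exact: xl.
Qed.

Lemma norm_dot2_le (a b c d : R) :
  `|a * c + b * d| <= a ^+ 2 + b ^+ 2 + (c ^+ 2 + d ^+ 2).
Proof.
have := (sqr_ge0 (a - c), sqr_ge0 (a + c), sqr_ge0 (b - d), sqr_ge0 (b + d)).
move: (sqr_ge0 a) (sqr_ge0 b) (sqr_ge0 c) (sqr_ge0 d).
rewrite !sqrrB !sqrrD => ? ? ? ? [[[? ?] ?] ?].
by rewrite ler_norml; apply/andP; split; lra.
Qed.

Lemma is_cvg_ell2_dot (x y : nat -> R[i]) : ell2 x -> ell2 y ->
  cvgn (series ((fun n => x n * Num.conj (y n)) : nat -> R[i]^o)).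
Proof.
move=> /ell2_re x2 /ell2_re y2.
have xy2 := is_cvg_seriesD x2 y2.
apply: is_cvg_series_complex.
  apply: normed_cvg; apply: series_le_cvg xy2 => n //=.
    by rewrite addr_ge0// addr_ge0// sqr_ge0.
  by rewrite reM reJ imJ mulrN opprK norm_dot2_le.
apply: normed_cvg; apply: series_le_cvg xy2 => n //=.
  by rewrite addr_ge0// addr_ge0// sqr_ge0.
have := norm_dot2_le (- Re (x n)) (Im (x n)) (Im (y n)) (Re (y n)).
by rewrite imM reJ imJ sqrrN mulNr -mulrN (addrC (Im (y n) ^+ 2)).
Qed.

End ComplexSeries.

Section CompletelyPositiveIsFPositive.
Variables (R : realType) (S : starMonoidType).

Lemma ell2_dot_comb (I J : Type) (r : seq I) (r' : seq J)
    (a : I -> R[i]) (b : J -> R[i]) (x : I -> nat -> R[i]) (y : J -> nat -> R[i]) :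
  (forall i j, cvgn (series ((fun n => x i n * Num.conj (y j n)) : nat -> R[i]^o))) ->
  series ((fun n => (\sum_(i <- r) a i * x i n) *
     Num.conj (\sum_(j <- r') b j * y j n)) : nat -> R[i]^o) @ \oo -->
  (\sum_(i <- r) \sum_(j <- r') a i * Num.conj (b j) * ell2_dot (x i) (y j) : R[i]^o).
Proof.
move=> cxy; pose rr := [seq (i, j) | i <- r, j <- r'].
have := @cvg_series_comb R _ rr (fun q => a q.1 * Num.conj (b q.2)) _
  (fun q => cxy q.1 q.2).
rewrite big_allpairs /=; apply: cvg_trans.
have -> // : (fun n => (\sum_(i <- r) a i * x i n) *
    Num.conj (\sum_(j <- r') b j * y j n)) = fun n => \sum_(q <- rr)
    a q.1 * Num.conj (b q.2) * (x q.1 n * Num.conj (y q.2 n)).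
apply/funext => n; rewrite big_allpairs /= mulr_suml; apply: eq_bigr => i _.
rewrite rmorph_sum mulr_sumr; apply: eq_bigr => j _.
by rewrite rmorphM; ring.
Qed.

Variables (T : set S) (D : lmodType R[i]) (Phi : T -> sform D).

Theorem cp_cfp (Y : set (character R S)) : determining Y ->
  completely_positive (Lambda [set: character R S] Phi) ->
  completely_f_positive (Lambda Y Phi).
Proof.
move=> Y_det cp m W m0 [p [p_poly pW]].
have [r Hr] := choice p_poly.
have [x Hx] := choice Hr.
have W_rep (kl : 'I_m * 'I_m) :
    exists (w : {n : nat & (('I_n -> R[i]) * ('I_n -> T))%type}),
    W kl.1 kl.2 = \sum_i (projT2 w).1 i *: hatT Y ((projT2 w).2 i).
  by have [n [c [s e]]] := polyT_rep (W kl.1 kl.2); exists (existT _ n (c, s)).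
have [w wE] := choice W_rep.
(* The same formal combinations read on all characters; both maps [Lambda] depend only on the
   coefficients, so they agree on [W'] and [W]. *)
pose W' := \matrix_(k < m, l < m) \sum_i (projT2 (w (k, l))).1 i *:
  hatT [set: character R S] ((projT2 (w (k, l))).2 i).
have LW' : map_mx (Lambda [set: character R S] Phi) W' = map_mx (Lambda Y Phi) W.
  apply/matrixP => k l; rewrite !mxE (wE (k, l)).
  rewrite (Lambda_spec_sum _ _ (LambdaP Phi (determiningT Y_det))).
  by rewrite (Lambda_spec_sum _ _ (LambdaP Phi Y_det)).
rewrite -LW'; apply: cp => // chi.
pose P k n := \sum_(s <- r k) set_val chi s * x k s n.
have xdot k l s t :
    cvgn (series ((fun n => x k s n * Num.conj (x l t n)) : nat -> R[i]^o)).
  by have [_ xk _ _] := Hx k; have [_ xl _ _] := Hx l; exact: is_cvg_ell2_dot.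
have PdotE k l :=
  @ell2_dot_comb _ _ (r k) (r l) (set_val chi) (set_val chi) _ _ (xdot k l).
have W'E k l : W' k l chi = ell2_dot (P k) (P l).
  rewrite /ell2_dot (cvg_lim _ (PdotE k l))// mxE polyT_sumE.
  pose rr := [seq (s, t) | s <- r k, t <- r l].
  set n := projT1 (w (k, l)).
  (* Both sides become one formal relation: [inl] carries the terms of [W], [inr] those of the inner
     product, where chi(s) times the conjugate of chi(t) is chi(t^* s). *)
  pose I : Type := ('I_n + S * S)%type.
  pose c (i : I) := match i with inl j => (projT2 (w (k, l))).1 j
    | inr q => - ell2_dot (x k q.1) (x l q.2) end.
  pose sg (i : I) := match i with inl j => set_val ((projT2 (w (k, l))).2 j)
    | inr q => (q.2^-1 * q.1)%g end.
  have sumI (chi' : character R S) :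
      \sum_(i <- map inl (index_enum 'I_n) ++ map inr rr) c i * chi' (sg i) =
      \sum_j (projT2 (w (k, l))).1 j * chi' (set_val ((projT2 (w (k, l))).2 j)) -
      \sum_(s <- r k) \sum_(t <- r l)
         chi' s * Num.conj (chi' t) * ell2_dot (x k s) (x l t).
    rewrite big_cat !big_map /=; congr (_ + _).
    rewrite big_allpairs /= -sumrN; apply: eq_bigr => s _.
    rewrite -sumrN; apply: eq_bigr => t _.
    by rewrite charM charV; ring.
  apply/eqP; rewrite -subr_eq0 -sumI; apply/eqP.
  apply: (determining_formal (V := R[i]^o) Y_det _ (set_val chi)) => chi' Ychi'.
  rewrite sumI; pose chiY : Y := SigSub (mem_set Ychi').
  have := pW k l chiY; rewrite (wE (k, l)) polyT_sumE /= => ->.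
  have [_ _ _ ->] := Hx k; have [_ _ _ ->] := Hx l.
  have := @ell2_dot_comb _ _ (r k) (r l) chi' chi' _ _ (xdot k l).
  by rewrite /ell2_dot => /cvg_lim -> //; rewrite subrr.
move=> z; clearbody W'.
have cP k l : cvgn (series ((fun n => P k n * Num.conj (P l n)) : nat -> R[i]^o)).
  by apply/cvg_ex; eexists; exact: (PdotE k l).
(* The quadratic form of a Gram matrix is a squared norm, here that of the combination of the [P k]
   with coefficients conj(z k). *)
pose u : nat -> R[i]^o := fun n => (\sum_k Num.conj (z k 0) * P k n) *
  Num.conj (\sum_l Num.conj (z l 0) * P l n).
have uE : series u @ \oo --> (\sum_k \sum_l Num.conj (z k 0) *
    Num.conj (Num.conj (z l 0)) * ell2_dot (P k) (P l) : R[i]^o).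
  exact: ell2_dot_comb cP.
have -> : (map_mx Num.conj z^T *m \matrix_(k, l) W' k l chi *m z) 0 0 = limn (series u).
  rewrite (cvg_lim _ uE)// mxE exchange_big; apply: eq_bigr => l _.
  rewrite mxE mulr_suml; apply: eq_bigr => k _.
  by rewrite !mxE W'E conjCK; ring.
apply: lim_series_ge0; first by apply/cvg_ex; eexists; exact: uE.
by move=> n; rewrite /u mul_conjC_ge0.
Qed.

End CompletelyPositiveIsFPositive.

(** * From moments to complete positivity *)

Section SumIntegralGe0.
Context d (X : measurableType d) (R : realType) (Q : finType).
Variables (m : Q -> {finite_measure set X -> \bar R}) (a : Q -> X -> R).
Hypothesis a_int : forall q, (m q).-integrable setT (EFin \o a q).

Let a_meas q : measurable_fun setT (a q).
Proof. exact/measurable_EFinP/(measurable_int _ (a_int q)). Qed.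

Hypothesis pos : forall A x, measurable A -> 0 <= \sum_q a q x * fine (m q A).

Section Cells.
Variable e : R.
Hypothesis e0 : 0 < e.

(** Integer vectors are countable, so [pickle] numbers the cells; on each of them every [a q] varies
    by less than [e]. *)
Let key (x : X) : nat := pickle [ffun q => Num.floor (a q x / e)].
Let cell k := key @^-1` [set k].

Let cellE k x y : cell k x -> cell k y <->
  forall q, (Num.floor (a q x / e))%:~R * e <= a q y <
            (Num.floor (a q x / e) + 1)%:~R * e.
Proof.
rewrite /cell /= => <-; split=> [/(pcan_inj pickleK_inv)/ffunP xy q|xy].
  have := xy q; rewrite !ffunE => <-.
  by rewrite -ler_pdivlMr// -ltr_pdivrMr// floor_itv.
congr pickle; apply/ffunP => q; rewrite !ffunE; apply: floor_def.
by rewrite ler_pdivlMr// ltr_pdivrMr.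
Qed.

Let cell_measurable k : measurable (cell k).
Proof.
have [[x kx]|ne] := pselect (cell k !=set0); last first.
  have -> : cell k = set0 by apply/seteqP; split=> // x kx; case: ne; exists x.
  exact: measurable0.
have -> : cell k = \big[setI/setT]_q (a q @^-1`
    `[(Num.floor (a q x / e))%:~R * e, (Num.floor (a q x / e) + 1)%:~R * e[).
  rewrite -bigcap_seq; apply/seteqP; split=> y /=.
    by move=> /(cellE y kx) h q _ /=; rewrite in_itv /=.
  move=> h; apply/(cellE y kx) => q; have := h q; rewrite /= in_itv; apply.
  exact: mem_index_enum.
apply: bigsetI_measurable => q _; rewrite -[X in measurable X]setTI.
exact: a_meas.
Qed.

Let cell_close k x y q : cell k x -> cell k y -> a q x <= a q y + e.
Proof.
move=> kx /(cellE y kx)/(_ q)/andP[h _]; have [h' _] := cellE x kx.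
have /andP[_ /ltW/le_trans->//] := h' kx q.
by rewrite rmorphD mulrDl mul1r lerD2r.
Qed.

Let normA_int q : (m q).-integrable setT (EFin \o (fun x => `|a q x|)).
Proof. exact: (integrable_abse (a_int q)). Qed.

Let ae_int q : (m q).-integrable setT (EFin \o (fun x => a q x + e)).
Proof.
rewrite (_ : EFin \o _ = (EFin \o a q) \+ (EFin \o cst e))//.
by apply: integrableD => //; [exact: a_int|exact: finite_measure_integrable_cst].
Qed.

Let P_int q : (m q).-integrable setT (EFin \o (fun x => `|a q x| + (a q x + e))).
Proof.
rewrite (_ : EFin \o _ =
  (EFin \o (fun x => `|a q x|)) \+ (EFin \o (fun x => a q x + e)))//.
by apply: integrableD => //; [exact: normA_int|exact: ae_int].
Qed.

Let sub_int q (f : X -> R) (A : set X) : measurable A ->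
  (m q).-integrable setT (EFin \o f) -> (m q).-integrable A (EFin \o f).
Proof. by move=> mA; apply: integrableS. Qed.

(** [pos] is applied to the cell and to one of its points, where [a q] is at most [a q + e] taken
    anywhere in the cell. Adding the absolute value of [a q] to both sides makes both integrands
    nonnegative, so that the inequality can be summed over all cells. *)
Let cell_le k :
  (\sum_q \int[m q]_(x in cell k) (`|a q x|)%:E <=
   \sum_q \int[m q]_(x in cell k) (`|a q x| + (a q x + e))%:E)%E.
Proof.
have [[x kx]|ne] := pselect (cell k !=set0); last first.
  have -> : cell k = set0 by apply/seteqP; split=> // x kx; case: ne; exists x.
  by apply: lee_sum => q _; rewrite !integral_set0.
have mk := cell_measurable k.
have fN q : (\int[m q]_(x in cell k) (`|a q x|)%:E)%E =
    (Rintegral (m q) (cell k) (fun x => `|a q x|))%:E.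
  by rewrite /Rintegral fineK// integrable_fin_num//; exact: sub_int (normA_int q).
have fP q : (\int[m q]_(x in cell k) (`|a q x| + (a q x + e))%:E)%E =
    (Rintegral (m q) (cell k) (fun x => `|a q x| + (a q x + e)))%:E.
  by rewrite /Rintegral fineK// integrable_fin_num//; exact: sub_int (P_int q).
under eq_bigr do rewrite fN; under [leRHS]eq_bigr do rewrite fP.
rewrite !sumEFin lee_fin -subr_ge0 -sumrB.
apply: le_trans (pos x mk) _; apply: ler_sum => q _.
rewrite RintegralD//; [|exact: sub_int (normA_int q)|exact: sub_int (ae_int q)].
rewrite addrAC subrr add0r -Rintegral_cst//.
apply: le_Rintegral => //.
- exact: finite_measure_integrable_cst.
- exact: sub_int (ae_int q).
- by move=> y ky; exact: (cell_close q kx ky).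
Qed.

Let cell_cover : \bigcup_k cell k = setT.
Proof. by apply/seteqP; split=> // x _; exists (key x). Qed.

Let cell_trivIset : trivIset setT cell.
Proof. exact: trivIset_preimage1. Qed.

Let split_cells q (f : X -> R) : (forall x, 0 <= f x) -> measurable_fun setT f ->
  (\int[m q]_x (f x)%:E = \sum_(k <oo) \int[m q]_(x in cell k) (f x)%:E)%E.
Proof.
move=> f0 mf; rewrite -{1}cell_cover ge0_integral_bigcup//.
  by rewrite cell_cover; exact/measurable_EFinP.
by move=> x _; rewrite lee_fin.
Qed.

Lemma sum_integral_ge0_approx : 0 <= \sum_q Rintegral (m q) setT (a q) +
  e * \sum_q fine (m q setT).
Proof.
have P0 q x : 0 <= `|a q x| + (a q x + e).
  rewrite addrA addr_ge0 ?(ltW e0)//.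
  by have := ler_norm (- a q x); rewrite normrN; lra.
have : (\sum_q \int[m q]_x (`|a q x|)%:E <=
    \sum_q \int[m q]_x (`|a q x| + (a q x + e))%:E)%E.
  under eq_bigr => q _.
    rewrite split_cells//; last exact: measurableT_comp.
    over.
  under [leRHS]eq_bigr => q _.
    rewrite split_cells//; last exact/measurable_EFinP/(measurable_int _ (P_int q)).
    over.
  rewrite -!nneseries_sum.
  - apply: lee_nneseries => k *; last exact: cell_le.
    by apply: sume_ge0 => q _; apply: integral_ge0 => x _; rewrite lee_fin.
  - by move=> q k _; apply: integral_ge0 => x _; rewrite lee_fin.
  - by move=> q k _; apply: integral_ge0 => x _; rewrite lee_fin.
have fN q : (\int[m q]_x (`|a q x|)%:E)%E =
    (Rintegral (m q) setT (fun x => `|a q x|))%:E.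
  by rewrite /Rintegral fineK// integrable_fin_num//; exact: normA_int.
have fP q : (\int[m q]_x (`|a q x| + (a q x + e))%:E)%E =
    (Rintegral (m q) setT (fun x => `|a q x| + (a q x + e)))%:E.
  by rewrite /Rintegral fineK// integrable_fin_num//; exact: P_int.
under eq_bigr do rewrite fN; under [leRHS]eq_bigr do rewrite fP.
rewrite !sumEFin lee_fin -subr_ge0 -sumrB => /le_trans; apply.
rewrite mulr_sumr -big_split; apply: ler_sum => q _.
rewrite RintegralD//; [|exact: normA_int|exact: ae_int].
rewrite addrAC subrr add0r RintegralD//; first by rewrite Rintegral_cst.
  exact: a_int.
exact: finite_measure_integrable_cst.
Qed.

End Cells.

Lemma sum_integral_ge0 : 0 <= \sum_q Rintegral (m q) setT (a q).
Proof.
set s := \sum_q _; pose c := \sum_q fine (m q setT).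
have c0 : 0 <= c by apply: sumr_ge0 => q _; exact: fine_ge0.
apply/ler_addgt0Pr => e e0; have c1 : 0 < c + 1 by lra.
(* The mesh makes the error c e / (c + 1), at most e; the 1 covers total mass zero. *)
have := @sum_integral_ge0_approx (e / (c + 1)); rewrite divr_gt0// => /(_ isT).
move=> /le_trans; apply; rewrite lerD2l -/c -mulrA ler_piMr ?ltW//.
by rewrite mulrC ltr_pdivrMr//; lra.
Qed.

End SumIntegralGe0.

(** * Schur products and polarization *)

Section PositiveForms.
Variable R : realType.
Local Notation Re := (@complex.Re R).
Local Notation Im := (@complex.Im R).

Lemma sform_pos_conj (D : lmodType R[i]) (phi : sform D) :
  (forall f, 0 <= phi f f) -> forall f g, phi f g = Num.conj (phi g f).
Proof.
move=> phi0.
have Im_diag f : Im (phi f f) = 0 by have := phi0 f; rewrite ge0_ReIm => /andP[/eqP].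
have Im0 f g : Im (phi f g) + Im (phi g f) = 0.
  by have := Im_diag (f + g); rewrite sformDl !sformDr !imD !Im_diag addr0 add0r.
move=> f g; apply: ReIm_eq; rewrite ?reJ ?imJ; last by have := Im0 f g; lra.
have := Im0 ('i%C *: f) g; rewrite sformZl sformZr !imM reJ imJ /=; lra.
Qed.

Lemma mx_nonneg_hermitian m (M : 'M[R[i]]_m) : mx_nonneg M ->
  forall k l, M k l = Num.conj (M l k).
Proof.
move=> M0; pose u (f g : 'cV[R[i]]_m) := (map_mx Num.conj g^T *m M *m f) 0 0.
have u_bilinear : bilinear_for ( *%R : GRing.Scale.law _ _)
    (Num.conj \; *%R : GRing.Scale.law _ _) u.
  split=> [g c f f'|f c g g']; rewrite /u /=.
    by rewrite linearP mxE mxE.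
  by rewrite linearP /= map_mxD map_mxZ !mulmxDl -!scalemxAl mxE mxE.
have := sform_pos_conj (phi := mk_sform u_bilinear) M0 => h k l.
have := h (delta_mx l 0) (delta_mx k 0); rewrite /= /u.
have E i j : (map_mx Num.conj (delta_mx i 0 : 'cV[R[i]]_m)^T *m M *m
    delta_mx j 0) 0 0 = M i j.
  rewrite trmx_delta map_delta_mx -rowE mxE (bigD1 j)//= !mxE !eqxx mulr1.
  by rewrite big1 ?addr0// => p /negPf pj; rewrite !mxE pj mulr0.
by rewrite !E.
Qed.

Lemma sform_sum_sum (D : lmodType R[i]) (phi : sform D) m (a b : 'I_m -> R[i])
    (h : 'I_m -> D) : phi (\sum_k a k *: h k) (\sum_l b l *: h l) =
  \sum_k \sum_l a k * Num.conj (b l) * phi (h k) (h l).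
Proof.
rewrite (sform_suml phi); apply: eq_bigr => k _.
rewrite (big_morph (phi (a k *: h k)) (sformDr phi _) (sform0r phi _)).
by apply: eq_bigr => l _; rewrite sformZl sformZr mulrA.
Qed.

(* Schur-type product: diagonalise M, so that the double sum becomes a
   nonnegative combination of diagonal values of phi. *)
Lemma mx_nonneg_sform m (M : 'M[R[i]]_m) (D : lmodType R[i]) (phi : sform D)
    (h : 'I_m -> D) : mx_nonneg M -> (forall f, 0 <= phi f f) ->
  0 <= \sum_k \sum_l M k l * phi (h k) (h l).
Proof.
move=> M0 phi0.
have /hermitian_normalmx/orthomx_spectralP M_eq : M \is hermsymmx.
  apply/is_hermitianmxP; rewrite expr0 scale1r; apply/matrixP => k l.
  by rewrite !mxE; exact: mx_nonneg_hermitian.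
have Pu := spectral_unitarymx M.
move: (spectralmx M) (spectral_diag M) M_eq Pu => P la M_eq Pu.
have PP : P *m (map_mx Num.conj P^T) = 1%:M by exact/unitarymxP.
rewrite invmx_unitary// in M_eq.
have la_ge0 j : 0 <= la 0 j.
  (* The conjugate of row [j] of [P] is a unit eigenvector, at which the quadratic form equals the
     eigenvalue. *)
  have := M0 (map_mx Num.conj (row j P)^T).
  rewrite -map_trmx trmxK -map_mx_comp (map_mx_id (@conjCK _)).
  rewrite {1}M_eq !mulmxA -row_mul PP -!mulmxA.
  have -> : P *m (map_mx Num.conj (row j P))^T = col j 1%:M.
    rewrite -PP !colE -mulmxA -colE; congr (_ *m _).
    by apply/matrixP => a b; rewrite !mxE.
  by rewrite row1 -rowE mul_diag_mx !mxE eqxx mulr1.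
have ME k l : M k l = \sum_j la 0 j * (Num.conj (P j k) * P j l).
  rewrite M_eq mul_mx_diag mxE; apply: eq_bigr => j _; rewrite !mxE; ring.
have -> : \sum_k \sum_l M k l * phi (h k) (h l) =
    \sum_j la 0 j * phi (\sum_k Num.conj (P j k) *: h k) (\sum_k Num.conj (P j k) *: h k).
  transitivity (\sum_k \sum_l \sum_j
      la 0 j * (Num.conj (P j k) * P j l) * phi (h k) (h l)).
    by apply: eq_bigr => k _; apply: eq_bigr => l _; rewrite ME mulr_suml.
  under eq_bigr do rewrite exchange_big; rewrite exchange_big /=.
  apply: eq_bigr => j _; rewrite sform_sum_sum mulr_sumr; apply: eq_bigr => k _.
  by rewrite mulr_sumr; apply: eq_bigr => l _; rewrite conjCK -[LHS]mulrA.
by apply: sumr_ge0 => j _; rewrite mulr_ge0.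
Qed.

Lemma sform_polarization (D : lmodType R[i]) (phi : sform D) f g :
  phi f g = \sum_(j < 4) 'i%C ^+ j / 4 * phi (f + 'i%C ^+ j *: g) (f + 'i%C ^+ j *: g).
Proof.
have ii : 'i%C * 'i%C = -1 :> R[i] by rewrite -expr2 sqr_i.
have iJ : Num.conj 'i%C = - 'i%C :> R[i] by apply: ReIm_eq; rewrite /= ?oppr0.
have expand t : phi (f + t *: g) (f + t *: g) =
    phi f f + Num.conj t * phi f g + t * phi g f + t * Num.conj t * phi g g.
  by rewrite sformDl 2!sformDr 2!sformZl 2!sformZr mulrA !addrA.
rewrite !big_ord_recr big_ord0 /= add0r !exprS expr0 !mulr1 ii.
rewrite !expand !mulrN1 !rmorphN /= !rmorph1 iJ.
move: (phi f f) (phi f g) (phi g f) (phi g g) => a b c e.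
(* Isolating a multiple of i i + 1 leaves an identity valid for a generic element in place of i,
   which [field] can check. *)
transitivity (b + ('i%C * 'i%C + 1) * ((c - b) / 2)).
  by rewrite ii addNr mul0r addr0.
by move: ('i%C : R[i]) => t; field.
Qed.

End PositiveForms.

(** * Complex integrals against finite positive measures *)

Section ChargeOfMeasure.
Local Open Scope complex_scope.
Context d (X : measurableType d) (R : realType).
Local Notation Re := (@complex.Re R).
Local Notation Im := (@complex.Im R).

(** On the negative set [nu] is both at most and at least 0. Here [m] is a bare set function, so
    that the lemma serves a measure as well as the zero function. *)
Lemma jordan_measure (nu : {charge set X -> \bar R}) (m : set X -> \bar R) P N
    (nuPN : hahn_decomposition nu P N) :
  (forall A, measurable A -> nu A = m A) ->
  (forall A, measurable A -> (0 <= m A)%E) ->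
  forall A, measurable A -> jordan_pos nuPN A = m A /\ jordan_neg nuPN A = 0%E.
Proof.
move=> num m0 A mA; have [[mP posP] [mN negN] PN PN0] := nuPN.
have mAN := measurableI _ _ mA mN.
have nuN : nu (A `&` N) = 0%E by apply/eqP; rewrite eq_le negN// num// m0.
rewrite jordan_posE charge.cjordan_posE jordan_negE charge.cjordan_negE.
rewrite /crestr0 mem_set// /crestr nuN oppe0 -(num _ mA); split=> //.
rewrite -[in RHS](setIT A) -PN setIUr chargeU ?nuN ?adde0//.
- exact: measurableI.
- by rewrite setIACA setIid PN0 setI0.
Qed.

Lemma eq_measure_integrable (m1 m2 : {measure set X -> \bar R}) (f : X -> \bar R) :
  (forall A, measurable A -> m1 A = m2 A) ->
  m1.-integrable setT f -> m2.-integrable setT f.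
Proof.
move=> m12 /integrableP[mf fi]; apply/integrableP; split=> //.
by rewrite (eq_measure_integral m1)// => A mA _; rewrite m12.
Qed.

Definition is_cintegral (m : {finite_measure set X -> \bar R}) (f : X -> R[i])
    (z : R[i]) :=
  [/\ m.-integrable setT (EFin \o (Re \o f)), m.-integrable setT (EFin \o (Im \o f)) &
    z = Rintegral m setT (Re \o f) +i* Rintegral m setT (Im \o f)].

(** The real part of [nu] is [m] and the imaginary part is 0, so three of the four Jordan parts
    vanish on measurable sets. *)
Lemma is_complex_integral_measure (nu : set X -> R[i])
    (m : {finite_measure set X -> \bar R}) (f : X -> R[i]) z :
  (forall A, measurable A -> nu A = (fine (m A))%:C) ->
  is_complex_integral nu f z -> is_cintegral m f z.
Proof.
move=> num [nu1 [nu2 [nuE [[re1 _] [im1 _]] _ ->]]].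
have nu1E A : measurable A -> nu1 A = m A.
  move=> mA; have := nuE _ mA; rewrite num// => -[e _].
  by rewrite -[LHS]fineK ?fin_num_measure// -e fineK// fin_num_measure.
have nu2E A : measurable A -> nu2 A = 0%E.
  move=> mA; have := nuE _ mA; rewrite num// => -[_ e].
  by rewrite -[LHS]fineK ?fin_num_measure// -e.
(* The very decomposition chosen inside [charge_pos] and [charge_neg]. *)
pose hahn nu' := projT2 (cid (projT2 (cid (@Hahn_decomposition _ X R nu')))).
have J1 A mA := @jordan_measure _ _ _ _ (hahn nu1) nu1E (fun A _ => measure_ge0 m A) A mA.
have J2 A mA :=
  @jordan_measure _ (fun=> 0%E) _ _ (hahn nu2) nu2E (fun _ _ => lexx _) A mA.
have pos1 A : measurable A -> charge_pos nu1 A = m A by move=> /J1[].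
have neg1 A : measurable A -> charge_neg nu1 A = 0%E by move=> /J1[].
have pos2 A : measurable A -> charge_pos nu2 A = 0%E by move=> /J2[].
have neg2 A : measurable A -> charge_neg nu2 A = 0%E by move=> /J2[].
have Rint_eq (m1 m2 : {measure set X -> \bar R}) (g : X -> R) :
    (forall A, measurable A -> m1 A = m2 A) ->
    Rintegral m1 setT g = Rintegral m2 setT g.
  by move=> e; congr fine; apply: eq_measure_integral => A mA _; exact: e.
have Rint0 (m1 : {measure set X -> \bar R}) (g : X -> R) :
    (forall A, measurable A -> m1 A = 0%E) -> Rintegral m1 setT g = 0.
  by move=> e; rewrite (Rint_eq _ mzero)// /Rintegral integral_measure_zero.
split; [exact: eq_measure_integrable re1|exact: eq_measure_integrable im1|].
rewrite /charge_integral !(Rint0 (charge_neg _))// !(Rint0 (charge_pos nu2))//.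
by rewrite !(Rint_eq _ _ _ pos1) !subr0 addr0.
Qed.

Lemma integrable_comb (m : {finite_measure set X -> \bar R}) (a b : R) (f g h : X -> R) :
  m.-integrable setT (EFin \o f) -> m.-integrable setT (EFin \o g) ->
  m.-integrable setT (EFin \o h) ->
  m.-integrable setT (EFin \o (fun x => a * f x + b * g x + h x)) /\
  Rintegral m setT (fun x => a * f x + b * g x + h x) =
  a * Rintegral m setT f + b * Rintegral m setT g + Rintegral m setT h.
Proof.
move=> fi gi hi.
have afi : m.-integrable setT (EFin \o (fun x => a * f x)).
  by rewrite (_ : EFin \o _ = fun x => (a%:E * (EFin \o f) x)%E)//; exact: integrableZl.
have bgi : m.-integrable setT (EFin \o (fun x => b * g x)).
  by rewrite (_ : EFin \o _ = fun x => (b%:E * (EFin \o g) x)%E)//; exact: integrableZl.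
have abi : m.-integrable setT (EFin \o (fun x => a * f x + b * g x)).
  rewrite (_ : EFin \o _ =
    (EFin \o (fun x => a * f x)) \+ (EFin \o (fun x => b * g x)))//.
  exact: integrableD afi bgi.
split; last by rewrite RintegralD// RintegralD// !RintegralZl.
rewrite (_ : EFin \o _ = (EFin \o (fun x => a * f x + b * g x)) \+ (EFin \o h))//.
exact: integrableD abi hi.
Qed.

Lemma is_cintegral_lin m (a : R[i]) f g z w : is_cintegral m f z ->
  is_cintegral m g w -> is_cintegral m (fun x => a * f x + g x) (a * z + w).
Proof.
move=> [rf imf ->] [rg ig ->].
have [re_int re_eq] := integrable_comb (Re a) (- Im a) rf imf rg.
have [im_int im_eq] := integrable_comb (Re a) (Im a) imf rf ig.
have reE : Re \o (fun x => a * f x + g x) =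
    fun x => Re a * (Re \o f) x + - Im a * (Im \o f) x + (Re \o g) x.
  by apply/funext => x; rewrite /= reD reM mulNr.
have imE : Im \o (fun x => a * f x + g x) =
    fun x => Re a * (Im \o f) x + Im a * (Re \o f) x + (Im \o g) x.
  by apply/funext => x; rewrite /= imD imM.
split; rewrite ?reE ?imE//; apply: ReIm_eq.
  by rewrite reD reM /= re_eq mulNr.
by rewrite imD imM /= im_eq.
Qed.

Lemma is_cintegral0 m : is_cintegral m (fun=> 0) 0.
Proof.
have i0 : m.-integrable setT (EFin \o cst (0 : R)).
  exact: finite_measure_integrable_cst.
split=> //; first by apply: ReIm_eq => /=; rewrite /comp /= Rintegral_cst ?mul0r.
Qed.

Lemma is_cintegral_sum m n (c : 'I_n -> R[i]) (f : 'I_n -> X -> R[i]) (z : 'I_n -> R[i]) :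
  (forall i, is_cintegral m (f i) (z i)) ->
  is_cintegral m (fun x => \sum_i c i * f i x) (\sum_i c i * z i).
Proof.
move=> fz; elim: (index_enum _) => [|i s IH].
  by under eq_fun do rewrite big_nil; rewrite big_nil; exact: is_cintegral0.
under eq_fun do rewrite big_cons.
by rewrite big_cons; exact: is_cintegral_lin.
Qed.

Lemma sum_cintegral_ge0 (Q : finType) (m : Q -> {finite_measure set X -> \bar R})
    (a : Q -> X -> R[i]) (z : Q -> R[i]) :
  (forall q, is_cintegral (m q) (a q) (z q)) ->
  (forall A x, measurable A -> 0 <= \sum_q a q x * (fine (m q A))%:C) ->
  0 <= \sum_q z q.
Proof.
move=> az pos.
have reim A x : measurable A -> 0 <= \sum_q Re (a q x) * fine (m q A) /\
    \sum_q Im (a q x) * fine (m q A) = 0.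
  move=> /pos -/(_ x); rewrite ge0_ReIm re_sum im_sum => /andP[/eqP im0 re0]; split.
    apply: le_trans re0 _; rewrite le_eqVlt; apply/orP; left; apply/eqP.
    by apply: eq_bigr => q _; rewrite reM /= mulr0 subr0.
  rewrite -[RHS]im0; apply: eq_bigr => q _; rewrite imM /=; ring.
rewrite ge0_ReIm re_sum im_sum; apply/andP; split.
  have imz q : Im (z q) = Rintegral (m q) setT (Im \o a q) by have [_ _ ->] := az q.
  have imi q : (m q).-integrable setT (EFin \o (Im \o a q)) by have [] := az q.
  under eq_bigr do rewrite imz.
  (* The imaginary sums vanish pointwise, so [sum_integral_ge0] applies to them with either sign. *)
  rewrite eq_le; apply/andP; split; last first.
    by apply: sum_integral_ge0 => // A x mA; have [_ ->] := reim A x mA.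
  rewrite -oppr_ge0 -sumrN.
  have nE q : - Rintegral (m q) setT (Im \o a q) =
      Rintegral (m q) setT (fun x => -1 * (Im \o a q) x).
    by rewrite RintegralZl//; [rewrite mulN1r|exact: imi].
  under eq_bigr do rewrite nE.
  apply: sum_integral_ge0 => [q|A x mA].
    rewrite (_ : EFin \o _ = fun x => ((-1)%:E * (EFin \o (Im \o a q)) x)%E)//.
    exact: integrableZl (imi q).
  under eq_bigr do rewrite mulN1r mulNr.
  by rewrite sumrN; have [_ ->] := reim A x mA; rewrite oppr0.
have rez q : Re (z q) = Rintegral (m q) setT (Re \o a q) by have [_ _ ->] := az q.
under eq_bigr do rewrite rez.
apply: sum_integral_ge0 => [q|A x mA]; first by have [] := az q.
by have [] := reim A x mA.
Qed.

End ChargeOfMeasure.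

Section MomentsArePositive.
Local Open Scope complex_scope.
Variables (R : realType) (S : starMonoidType) (D : lmodType R[i]).
Variables (T : set S) (Phi : T -> sform D).

Theorem moment_cp (mu : set (character R S) -> sform D) :
  determining [set: character R S] -> semispectral mu ->
  (forall s : T, is_moment mu (set_val s) (Phi s)) ->
  completely_positive (Lambda [set: character R S] Phi).
Proof.
move=> dT semi mom m W _ Wpos h.
have [ms msE] := choice semi.
pose lift (chi : character R S) : [set: character R S] := SigSub (mem_set (I : setT chi)).
have Lint (w : polyT T [set: character R S]) f :
  is_cintegral (ms f) (fun chi => w (lift chi))
    (Lambda [set: character R S] Phi w f f).
  have [n [c [s ->]]] := polyT_rep w.
  rewrite (Lambda_spec_sum _ _ (LambdaP Phi dT)) sform_sumE.
  under eq_fun do rewrite polyT_sumE.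
  have -> : \sum_i (c i *: Phi (s i)) f f = \sum_i c i * Phi (s i) f f.
    by apply: eq_bigr => i _; rewrite sformZE.
  apply: is_cintegral_sum => i.
  exact: (is_complex_integral_measure (msE f) (mom (s i) f f)).
(* A matrix entry together with one of the four polarization terms, so that each index meets a
   positive measure [ms (v q)]. *)
pose Q := ('I_m * 'I_m * 'I_4)%type.
pose v (q : Q) := h q.1.1 + 'i%C ^+ q.2 *: h q.1.2.
pose a (q : Q) chi := 'i%C ^+ q.2 / 4 * W q.1.1 q.1.2 (lift chi).
pose z (q : Q) := 'i%C ^+ q.2 / 4 *
  Lambda [set: character R S] Phi (W q.1.1 q.1.2) (v q) (v q).
have sumQ (F : Q -> R[i]) : \sum_k \sum_l \sum_j F (k, l, j) = \sum_q F q.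
  rewrite pair_bigA /= pair_bigA /=.
  by apply: eq_bigr => -[[k l] j] _.
have -> : \sum_k \sum_l map_mx (Lambda [set: character R S] Phi) W k l (h k) (h l) =
    \sum_q z q.
  rewrite -sumQ; apply: eq_bigr => k _; apply: eq_bigr => l _.
  by rewrite mxE sform_polarization.
apply: (@sum_cintegral_ge0 _ _ _ _ (fun q => ms (v q)) a) => [q|A chi mA].
  have := is_cintegral_lin ('i%C ^+ q.2 / 4) (Lint (W q.1.1 q.1.2) (v q))
    (is_cintegral0 _).
  by rewrite addr0; under eq_fun do rewrite addr0.
rewrite -sumQ.
(* Undoing the polarization for the fixed set [A] leaves the pairing of the matrix W(chi) with the
   form [mu A], to which the Schur-type lemma applies. *)
have -> : \sum_k \sum_l \sum_j a (k, l, j) chi * (fine (ms (v (k, l, j)) A))%:C =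
    \sum_k \sum_l (\matrix_(k, l) W k l (lift chi)) k l * mu A (h k) (h l).
  apply: eq_bigr => k _; apply: eq_bigr => l _.
  rewrite mxE (sform_polarization (mu A)) mulr_sumr; apply: eq_bigr => j _.
  by rewrite /a /= -msE// /v /= mulrCA mulrA.
apply: mx_nonneg_sform => // f.
by rewrite msE// ler0c fine_ge0.
Qed.

End MomentsArePositive.

Theorem theorem14 (R : realType) (S : starMonoidType)
  (semiperfect : operator_semiperfect R S)
  (T : set S) (T_symmetric : T = [set (s^-1)%g | s in T])
  (T_hermitian : [set s : S | s = (s^-1)%g] `<=` T)
  (Y : set (character R S)) (Y_determining : determining Y)
  (D : lmodType R[i]) (Phi : T -> sform D) :
  [<-> (* (i) *)
       exists Psi : S -> sform D,
         positive_definite Psi /\ forall s : T, Psi (set_val s) = Phi s;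
       (* (ii) *)
       exists mu : set (character R S) -> sform D,
         semispectral mu /\ forall s : T, is_moment mu (set_val s) (Phi s);
       (* (iii) *)
       completely_positive (Lambda [set: character R S] Phi);
       (* (iv) *)
       completely_f_positive (Lambda Y Phi)].
Proof.
tfae.
- move=> [Psi [Psi_pd PsiE]]; have [mu [mu_semi mu_mom]] := semiperfect.2 D Psi Psi_pd.
  by exists mu; split=> // s; rewrite -PsiE; exact: mu_mom.
- move=> [mu [mu_semi mu_mom]]; apply: moment_cp mu_mom => //.
  exact: determiningT Y_determining.
- exact: cp_cfp.
- apply: cfp_extends => // s Ts.
  by rewrite T_symmetric; exists s.
Qed.
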